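(* Suppose $f_0>0$ on $\mathbb{T}$ is band-limited, namely, there exists some $K\in\mathbb{N}$ such that $\mathcal{F}(f_0)_k=0$ for all $|k|>K$. Then the equation $$\partial_tf=\mathcal{H}f\cdot\partial_xf-f(-\Delta)^{\frac12}f,\qquad f(x,0)=f_0(x),$$ has a global strong solution $f=f(x,t)$ (on $\mathbb{T}\times[0,+\infty)$) that is also positive and band-limited, such that $\hat f_k(t)=0$ for all $|k|>K$ and $t\ge0$. Such a solution is unique, and it can be determined by solving a finite family of ODEs of its Fourier coefficients. In fact, let $\hat f_k(t)\equiv0$ for all $|k|>K$, and denote $\bar f(t):=\mathcal{F}(f(\cdot,t))_0=\frac1{2\pi}\int_{\mathbb{T}}f(x,t)\,dx$. Then for integers $k\in[0,K]$, $\hat f_k(t)=\mathcal{F}(f(\cdot,t))_k$ solves $$\frac{d}{dt}\hat f_k(t)=-k\bar f(t)\hat f_k(t)-\sum_{j>0}2(k+2j)\hat f_{k+j}(t)\overline{\hat f_j(t)},\qquad\hat f_k(0)=\mathcal{F}(f_0)_k,$$ where $\hat f_0(t)$ should be understood as $\bar f(t)$; and $\hat f_k(t)=\overline{\hat f_{-k}(t)}$ for $k\in[-K,0)$.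
   Context: $\mathbb{T}=\mathbb{R}/(2\pi\mathbb{Z})=[-\pi,\pi)$; $\mathcal{H}f(x)=\frac1\pi\mathrm{p.v.}\int_{\mathbb{T}}\frac{f(y)}{2\tan(\frac{x-y}{2})}\,dy$ and $(-\Delta)^{\frac12}f(x)=\frac1\pi\mathrm{p.v.}\int_{\mathbb{T}}\frac{f(x)-f(y)}{4\sin^2(\frac{x-y}{2})}\,dy=\mathcal{H}f'(x)$. The Fourier coefficients of $f\in L^1(\mathbb{T})$ are $\mathcal{F}(f)_k=\hat f_k=\frac1{2\pi}\int_{\mathbb{T}}f(x)e^{-ikx}\,dx$. All functions $f$ are real-valued. For $T\in[0,+\infty]$, $f$ is a strong solution on $\mathbb{T}\times[0,T)$ if $f\in C^1_{loc}(\mathbb{T}\times[0,T))$, $(-\Delta)^{1/2}f$ can be defined pointwise as a function in $C_{loc}(\mathbb{T}\times[0,T))$, and the equation holds pointwise in $\mathbb{T}\times[0,T)$ (the time derivative at $t=0$ being the right derivative). ''Global'' means $T=+\infty$. *)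

(* Defs.v *)
From Stdlib Require Import Reals ZArith.
From Coquelicot Require Import Coquelicot.
Open Scope R_scope.

(* A function on the torus R/(2 PI Z) is a 2 PI-periodic function on R. *)
Definition periodic (f : R -> R) : Prop := forall x, f (x + 2 * PI) = f x.

(* [is_pv g x l] : the principal value at the singularity y = x of the integral
   of g over the torus is l.  The torus is cut open at the point antipodal to x,
   so that the part at distance at least eps from x is
   [x - PI, x - eps] U [x + eps, x + PI]. *)
Definition is_pv (g : R -> R) (x l : R) : Prop :=
  at_right 0 (fun eps => ex_RInt g (x - PI) (x - eps) /\
                         ex_RInt g (x + eps) (x + PI)) /\
  filterlim (fun eps => RInt g (x - PI) (x - eps) + RInt g (x + eps) (x + PI))
    (at_right 0) (locally l).

Definition is_Hilbert (f : R -> R) (x l : R) : Prop :=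
  exists I, is_pv (fun y => f y / (2 * tan ((x - y) / 2))) x I /\ l = / PI * I.

Definition is_half_Laplacian (f : R -> R) (x l : R) : Prop :=
  exists I, is_pv (fun y => (f x - f y) / (4 * (sin ((x - y) / 2)) ^ 2)) x I /\
            l = / PI * I.

Definition expi (theta : R) : C := (cos theta, sin theta).

Definition Fourier (f : R -> R) (k : Z) : C :=
  (RtoC (/ (2 * PI)) *
   RInt (V := C_R_CompleteNormedModule)
     (fun x => (RtoC (f x) * expi (- IZR k * x))%C) (- PI) PI)%C.

Definition band_limited (K : nat) (f : R -> R) : Prop :=
  forall k : Z, (Z.of_nat K < Z.abs k)%Z -> Fourier f k = RtoC 0.

Definition time (T : Rbar) (t : R) : Prop := 0 <= t /\ Rbar_lt t T.

(* Coquelicot's [is_derive] with the neighbourhoods of t restricted to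
   [0, T): the two-sided derivative for 0 < t < T, the right derivative at 0. *)
Definition is_time_derive {V : NormedModule R_AbsRing}
    (T : Rbar) (f : R -> V) (t : R) (l : V) : Prop :=
  filterdiff f (within (time T) (locally t)) (fun s => scal s l).

Definition continuous_spacetime (T : Rbar) (f : R -> R -> R) : Prop :=
  continuous_on (fun p : R * R => time T (snd p))
                (fun p : R * R => f (fst p) (snd p)).

(* f x t is the value at the point x and the time t; its values for t outside
   [0, T) are irrelevant.  fx, ft, Hf, Lf are the derivatives in x and in t, the
   Hilbert transform and the half-Laplacian of f. *)
Definition strong_solution (T : Rbar) (f : R -> R -> R) : Prop :=
  (forall t, time T t -> periodic (fun x => f x t)) /\
  exists fx ft Hf Lf : R -> R -> R,
    (forall x t, time T t ->
       is_derive (fun y => f y t) x (fx x t) /\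
       is_time_derive T (fun s => f x s) t (ft x t) /\
       is_Hilbert (fun y => f y t) x (Hf x t) /\
       is_half_Laplacian (fun y => f y t) x (Lf x t) /\
       ft x t = Hf x t * fx x t - f x t * Lf x t) /\
    continuous_spacetime T f /\
    continuous_spacetime T fx /\
    continuous_spacetime T ft /\
    continuous_spacetime T Lf.

Definition positive_band_limited_global_solution
    (K : nat) (f0 : R -> R) (f : R -> R -> R) : Prop :=
  strong_solution p_infty f /\
  (forall x, f x 0 = f0 x) /\
  (forall x t, 0 <= t -> 0 < f x t) /\
  (forall t, 0 <= t -> band_limited K (fun x => f x t)).

(* The system of ODEs for the Fourier coefficients c k t.  The sum over j > 0
   stops at K because c j t = 0 for j > K. *)
Definition Fourier_ODE (K : nat) (f0 : R -> R) (c : Z -> R -> C) : Prop :=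
  (forall k t, 0 <= t -> (Z.of_nat K < Z.abs k)%Z -> c k t = RtoC 0) /\
  (forall k t, 0 <= t -> (- Z.of_nat K <= k < 0)%Z ->
     c k t = Cconj (c (- k)%Z t)) /\
  (forall k, (0 <= k <= Z.of_nat K)%Z ->
     c k 0 = Fourier f0 k /\
     forall t, 0 <= t ->
       is_time_derive (V := C_R_NormedModule) p_infty (c k) t
         (- (RtoC (IZR k) * c 0%Z t * c k t)
          - sum_n_m (fun j : nat =>
               RtoC (2 * (IZR k + 2 * INR j)) * c (k + Z.of_nat j)%Z t
               * Cconj (c (Z.of_nat j) t)) 1 K)%C).

(* The sum over |k| <= K of c k * exp (i k x). *)
Definition trig_sum (K : nat) (c : Z -> C) (x : R) : C :=
  sum_n_m (fun n : nat =>
      let k := (Z.of_nat n - Z.of_nat K)%Z in (c k * expi (IZR k * x))%C)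
    0 (2 * K).

(* Main.v *)
(* A real trigonometric polynomial [f] with coefficients [c_k], [|k| <= K], solves
   the equation if and only if the [c_k] solve a quadratic system of ODEs: in the
   product [Hf * f_x - f * Lf] all frequencies above [K] cancel.  In this system
   the mean [c_0] is nonincreasing.  At a minimum point of [f > 0] one has
   [f_x = 0] and [Lf <= 0], so [min f] is nondecreasing; hence [f] stays
   positive, [|c_k| <= c_0 <= c_0(0)], and the solution is global.  Conversely, a
   band-limited solution is the trigonometric polynomial of its Fourier
   coefficients; these are linear combinations of its values at [2 K + 1] points,
   so they satisfy the system, and uniqueness for the system gives uniqueness
   for the equation. *)

(* Let [A] be the sum of the terms [c_k exp(i k x)] with [k > 0], and [B = -i A']. Then [Hf], [f_x],
   [Lf] are twice [Im A], [- Im B], [Re B]. In the equation the products [A B] cancel and only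
   [A conj(B)] remains, where frequencies subtract instead of adding; this keeps the band fixed. The
   bound on the coefficients needs [f >= 0], and positivity needs a solution to speak about. A
   truncated system, whose solutions are global, is therefore solved first; positivity and the
   inactivity of the truncation are then proved together, up to a first contact time. As [min f]
   need not be differentiable in time, [f] is compared with a strictly decreasing barrier. At time 0
   only right derivatives are available. Time is read through [Rabs], so that two-sided calculus
   applies on the whole line. That a band-limited function is the polynomial of its coefficients
   rests on the injectivity of the Fourier coefficients of continuous functions. This is proved by
   testing against trigonometric kernels that peak at a point, without any convergence of Fourier
   series. *)
Require Import Defs.
From Stdlib Require Import Reals ZArith Lra Lia Classical.
From Coquelicot Require Import Coquelicot.
Open Scope R_scope.

(** * Finite complex sums and the exponential *)

Definition csum (a : nat -> C) (n : nat) : C := sum_n_m a 1 n.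

Lemma csum_0 (a : nat -> C) : csum a 0 = 0%C.
Proof. unfold csum. rewrite sum_n_m_zero; [reflexivity | lia]. Qed.

Lemma csum_S (a : nat -> C) (n : nat) : csum a (S n) = (csum a n + a (S n))%C.
Proof. unfold csum. rewrite sum_n_Sm; [reflexivity | lia]. Qed.

Lemma csum_ext (a b : nat -> C) (n : nat) :
  (forall k, (1 <= k <= n)%nat -> a k = b k) -> csum a n = csum b n.
Proof. intros H. unfold csum. apply sum_n_m_ext_loc. exact H. Qed.

Lemma csum_plus (a b : nat -> C) (n : nat) :
  csum (fun k => a k + b k)%C n = (csum a n + csum b n)%C.
Proof.
  induction n as [|n IH]; [rewrite !csum_0 | rewrite !csum_S, IH]; ring.
Qed.

Lemma csum_mult_l (z : C) (a : nat -> C) (n : nat) :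
  csum (fun k => z * a k)%C n = (z * csum a n)%C.
Proof.
  induction n as [|n IH]; [rewrite !csum_0 | rewrite !csum_S, IH]; ring.
Qed.

Lemma csum_mult_r (z : C) (a : nat -> C) (n : nat) :
  csum (fun k => a k * z)%C n = (csum a n * z)%C.
Proof.
  induction n as [|n IH]; [rewrite !csum_0 | rewrite !csum_S, IH]; ring.
Qed.

Lemma csum_conj (a : nat -> C) (n : nat) :
  Cconj (csum a n) = csum (fun k => Cconj (a k)) n.
Proof.
  induction n as [|n IH].
  - rewrite !csum_0. unfold Cconj; simpl; apply injective_projections; simpl; ring.
  - now rewrite !csum_S, Cplus_conj, IH.
Qed.

Lemma csum_zero (a : nat -> C) (n : nat) :
  (forall k, (1 <= k <= n)%nat -> a k = 0%C) -> csum a n = 0%C.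
Proof.
  intros H; induction n as [|n IH]; [apply csum_0|].
  rewrite csum_S, IH, (H (S n)); [ring | lia | intros k Hk; apply H; lia].
Qed.

Lemma csum_swap (a : nat -> nat -> C) (n m : nat) :
  csum (fun i => csum (a i) m) n = csum (fun j => csum (fun i => a i j) n) m.
Proof.
  induction n as [|n IH].
  - rewrite csum_0. symmetry. apply csum_zero. intros; apply csum_0.
  - rewrite csum_S, IH, <- csum_plus. apply csum_ext. intros. now rewrite csum_S.
Qed.

Lemma csum_split (a : nat -> C) (j n : nat) :
  csum a (j + n) = (csum a j + csum (fun i => a (i + j)%nat) n)%C.
Proof.
  induction n as [|n IH].
  - rewrite Nat.add_0_r, csum_0; ring.
  - rewrite Nat.add_succ_r, !csum_S, IH.
    replace (S n + j)%nat with (S (j + n)) by lia; ring.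
Qed.

Lemma csum_truncate (a : nat -> C) (n m : nat) :
  (n <= m)%nat -> (forall k, (n < k <= m)%nat -> a k = 0%C) ->
  csum a m = csum a n.
Proof.
  intros Hnm H. replace m with (n + (m - n))%nat by lia.
  rewrite csum_split, (csum_zero (fun i => a (i + n)%nat)); [ring|].
  intros k Hk; apply H; lia.
Qed.

(* Both sums range over the pairs (i, j) with j < i. *)
Lemma csum_triangle (a : nat -> nat -> C) (n : nat) :
  csum (fun i => csum (a i) (i - 1)) n
  = csum (fun j => csum (fun d => a (d + j)%nat j) (n - j)) n.
Proof.
  induction n as [|n IH]; [now rewrite !csum_0|].
  rewrite !csum_S, IH, Nat.sub_diag, csum_0.
  replace (S n - 1)%nat with n by lia.
  rewrite (csum_ext (fun j => csum (fun d => a (d + j)%nat j) (S n - j))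
             (fun j => csum (fun d => a (d + j)%nat j) (n - j) + a (S n) j)%C).
  - rewrite csum_plus; ring.
  - intros k Hk. replace (S n - k)%nat with (S (n - k)) by lia.
    rewrite csum_S. now replace (S (n - k) + k)%nat with (S n) by lia.
Qed.

(** The pairs above and below the diagonal are both indexed by their difference [d]. As [a] vanishes
    outside the square, the inner sum may run to [n] instead of [n - d], which is the form of the
    sum in [coef_rhs]. *)
Lemma csum_square_diagonals (a : nat -> nat -> C) (n : nat) :
  (forall i j, (n < i \/ n < j)%nat -> a i j = 0%C) ->
  csum (fun i => csum (a i) n) n
  = (csum (fun j => a j j) n
     + csum (fun d => csum (fun j => a (d + j)%nat j + a j (d + j)%nat) n) n)%C.
Proof.
  intros Ha.
  assert (Htail : forall (b : nat -> nat -> C),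
    (forall i j, (n < i \/ n < j)%nat -> b i j = 0%C) ->
    csum (fun j => csum (fun d => b (d + j)%nat j) (n - j)) n
    = csum (fun d => csum (fun j => b (d + j)%nat j) n) n).
  { intros b Hb. rewrite csum_swap. apply csum_ext. intros j Hj.
    symmetry. apply csum_truncate; [lia|].
    intros k Hk. apply Hb. lia. }
  rewrite (csum_ext _ (fun i => csum (a i) (i - 1) + (a i i
      + csum (fun d => a i (d + i)%nat) (n - i)))%C).
  - rewrite !csum_plus, csum_triangle, (Htail a Ha).
    rewrite (Htail (fun i j => a j i)); [|intros; apply Ha; tauto].
    rewrite (csum_ext (fun d => csum (fun j => a (d + j)%nat j + a j (d + j)%nat)%C n)
      (fun d => csum (fun j => a (d + j)%nat j) n + csum (fun j => a j (d + j)%nat) n)%C).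
    + rewrite csum_plus; ring.
    + intros; apply csum_plus.
  - intros i Hi. replace n with (i + (n - i))%nat at 1 by lia.
    rewrite csum_split. replace i with (S (i - 1)) at 2 by lia.
    rewrite csum_S. replace (S (i - 1)) with i by lia. ring.
Qed.

(** Undoes the index shift of [trig_sum]; the induction peels off the two extreme terms at once. *)
Lemma csum_symmetric_range (a : Z -> C) (n : nat) :
  sum_n_m (fun i => a (Z.of_nat i - Z.of_nat n)%Z) 0 (2 * n)
  = (a 0%Z + csum (fun k => a (Z.of_nat k) + a (- Z.of_nat k)%Z)%C n)%C.
Proof.
  induction n as [|n IH].
  - rewrite csum_0. simpl. rewrite sum_n_n. simpl; ring.
  - rewrite csum_S.
    replace (2 * S n)%nat with (S (S (2 * n))) by lia.
    rewrite sum_n_Sm by lia. rewrite sum_Sn_m by lia.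
    rewrite <- sum_n_m_S.
    rewrite (sum_n_m_ext_loc _ (fun i => a (Z.of_nat i - Z.of_nat n)%Z) 0 (2 * n))
      by (intros k Hk; f_equal; lia).
    rewrite IH.
    replace (Z.of_nat 0 - Z.of_nat (S n))%Z with (- Z.of_nat (S n))%Z by lia.
    replace (Z.of_nat (S (S (2 * n))) - Z.of_nat (S n))%Z with (Z.of_nat (S n)) by lia.
    match goal with |- plus (plus ?p ?q) ?r = _ => change ((p + q + r)%C =
      (a 0%Z + (csum (fun k => a (Z.of_nat k) + a (- Z.of_nat k)%Z) n
        + (a (Z.of_nat (S n)) + a (- Z.of_nat (S n))%Z)))%C) end.
    ring.
Qed.

Lemma Cmod_csum_le (a : nat -> C) (M : R) (n : nat) :
  (forall k, (1 <= k <= n)%nat -> Cmod (a k) <= M) ->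
  Cmod (csum a n) <= INR n * M.
Proof.
  intros H; induction n as [|n IH].
  - rewrite csum_0, Cmod_0; simpl; lra.
  - rewrite csum_S, S_INR. eapply Rle_trans; [apply Cmod_triangle|].
    assert (Cmod (csum a n) <= INR n * M) by (apply IH; intros; apply H; lia).
    assert (Cmod (a (S n)) <= M) by (apply H; lia). lra.
Qed.

Lemma expi_plus (a b : R) : expi (a + b) = (expi a * expi b)%C.
Proof.
  unfold expi, Cmult; simpl; rewrite cos_plus, sin_plus; f_equal; ring.
Qed.

Lemma expi_0 : expi 0 = 1%C.
Proof. unfold expi; now rewrite cos_0, sin_0. Qed.

Lemma expi_opp (a : R) : expi (- a) = Cconj (expi a).
Proof. unfold expi, Cconj; simpl; now rewrite cos_neg, sin_neg. Qed.

Lemma Cmod_expi (a : R) : Cmod (expi a) = 1.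
Proof.
  unfold Cmod, expi; simpl. rewrite !Rmult_1_r.
  replace (cos a * cos a + sin a * sin a) with 1; [apply sqrt_1|].
  generalize (sin2_cos2 a); unfold Rsqr; lra.
Qed.

Lemma expi_2PI (n : nat) : expi (2 * INR n * PI) = 1%C.
Proof.
  rewrite <- expi_0. unfold expi.
  rewrite <- (cos_period 0 n), <- (sin_period 0 n). now rewrite Rplus_0_l.
Qed.

Lemma expi_periodic (k : nat) (x : R) :
  expi (INR k * (x + 2 * PI)) = expi (INR k * x).
Proof.
  replace (INR k * (x + 2 * PI)) with (INR k * x + 2 * INR k * PI) by ring.
  rewrite expi_plus, expi_2PI. apply Cmult_1_r.
Qed.

(** * Principal values of trigonometric polynomials *)

Lemma at_right_0_PI : at_right 0 (fun e => 0 < e < PI).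
Proof.
  exists (mkposreal PI PI_RGT_0). intros y Hy Hy0. split; [exact Hy0|].
  change (Rabs (y - 0) < PI) in Hy. rewrite Rminus_0_r, Rabs_pos_eq in Hy; lra.
Qed.

(** The cut-off is symmetric, so the two sides fold into one integral of [g (x - s) + g (x + s)]
    over [[eps, PI]], where an odd singularity cancels. An antiderivative [Phi] that is continuous
    at 0 then gives the limit. *)
Lemma is_pv_intro (g Phi : R -> R) (x : R) :
  (forall y, 0 < Rabs (y - x) <= PI -> continuous g y) ->
  (forall s, 0 < s <= PI -> is_derive Phi s (g (x - s) + g (x + s))) ->
  continuous Phi 0 ->
  is_pv g x (Phi PI - Phi 0).
Proof.
  intros Hg Hd Hc. pose proof PI_RGT_0 as HPI.
  assert (Hex1 : forall e, 0 < e < PI -> ex_RInt g (x - PI) (x - e)).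
  { intros e He. apply (ex_RInt_continuous (V := R_CompleteNormedModule)).
    intros z Hz. rewrite Rmin_left, Rmax_right in Hz by lra. apply Hg.
    rewrite Rabs_left1; lra. }
  assert (Hex2 : forall e, 0 < e < PI -> ex_RInt g (x + e) (x + PI)).
  { intros e He. apply (ex_RInt_continuous (V := R_CompleteNormedModule)).
    intros z Hz. rewrite Rmin_left, Rmax_right in Hz by lra. apply Hg.
    rewrite Rabs_pos_eq; lra. }
  split.
  - generalize at_right_0_PI. apply filter_imp. auto.
  - apply (filterlim_ext_loc (fun e => Phi PI - Phi e)).
    + generalize at_right_0_PI. apply filter_imp. intros e He.
      (* The substitution [y = x - s] reverses the interval; the sign from swapping the bounds
         compensates its factor -1. *)
      assert (H1 : is_RInt (fun s => g (x - s)) e PI (RInt g (x - PI) (x - e))).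
      { assert (H : is_RInt g (-1 * PI + x) (-1 * e + x) (RInt g (x - PI) (x - e))).
        { replace (-1 * PI + x) with (x - PI) by ring.
          replace (-1 * e + x) with (x - e) by ring.
          apply (RInt_correct (V := R_CompleteNormedModule)). auto. }
        apply (is_RInt_comp_lin (V := R_NormedModule)) in H.
        apply (is_RInt_swap (V := R_NormedModule)) in H.
        apply (is_RInt_opp (V := R_NormedModule)) in H. rewrite opp_opp in H.
        revert H. apply is_RInt_ext.
        intros s _. unfold scal, opp; simpl. unfold mult; simpl.
        replace (-1 * s + x) with (x - s) by ring. ring. }
      assert (H2 : is_RInt (fun s => g (x + s)) e PI (RInt g (x + e) (x + PI))).
      { assert (H : is_RInt g (1 * e + x) (1 * PI + x) (RInt g (x + e) (x + PI))).
        { replace (1 * PI + x) with (x + PI) by ring.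
          replace (1 * e + x) with (x + e) by ring.
          apply (RInt_correct (V := R_CompleteNormedModule)). auto. }
        apply (is_RInt_comp_lin (V := R_NormedModule)) in H.
        revert H. apply is_RInt_ext.
        intros s _. rewrite (scal_one (V := R_NormedModule)). f_equal. ring. }
      pose proof (is_RInt_plus _ _ _ _ _ _ H1 H2) as H12.
      apply (is_RInt_unique (V := R_CompleteNormedModule)) in H12.
      change (RInt (fun s => g (x - s) + g (x + s)) e PI = RInt g (x - PI) (x - e) + RInt g (x + e) (x + PI)) in H12.
      rewrite <- H12. symmetry. apply is_RInt_unique.
      apply (is_RInt_derive (V := R_CompleteNormedModule) Phi).
      * intros s Hs. rewrite Rmin_left, Rmax_right in Hs by lra. apply Hd. lra.
      * intros s Hs. rewrite Rmin_left, Rmax_right in Hs by lra.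
        apply (continuous_plus (V := R_NormedModule)).
        -- apply (continuous_comp (U := R_UniformSpace) (V := R_UniformSpace) (W := R_UniformSpace) (fun s => x - s) g).
           ++ apply (continuous_minus (V := R_NormedModule)); [apply continuous_const | apply continuous_id].
           ++ apply Hg. rewrite Rabs_left1; lra.
        -- apply (continuous_comp (U := R_UniformSpace) (V := R_UniformSpace) (W := R_UniformSpace) (fun s => x + s) g).
           ++ apply (continuous_plus (V := R_NormedModule)); [apply continuous_const | apply continuous_id].
           ++ apply Hg. rewrite Rabs_pos_eq; lra.
    + eapply filterlim_filter_le_1; [apply filter_le_within|].
      apply (continuous_minus (V := R_NormedModule) (fun _ => Phi PI) Phi); [apply continuous_const | exact Hc].
Qed.

Lemma is_pv_unique (g : R -> R) (x l l' : R) :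
  is_pv g x l -> is_pv g x l' -> l = l'.
Proof.
  intros [_ H] [_ H']. apply (filterlim_locally_unique (V := R_NormedModule) (K := R_AbsRing) _ _ _ H H').
Qed.

Lemma is_pv_ext (g h : R -> R) (x l : R) :
  (forall y, g y = h y) -> is_pv g x l -> is_pv h x l.
Proof.
  intros E [H1 H2]. split.
  - revert H1. apply filter_imp. intros e [Ha Hb].
    split; (eapply ex_RInt_ext; [intros; apply E | eassumption]).
  - apply (filterlim_ext (fun eps => RInt g (x - PI) (x - eps) + RInt g (x + eps) (x + PI))); [|exact H2].
    intros e. f_equal; apply RInt_ext; intros; apply E.
Qed.

Lemma is_pv_plus (g h : R -> R) (x l m : R) :
  is_pv g x l -> is_pv h x m -> is_pv (fun y => g y + h y) x (l + m).
Proof.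
  intros [G1 G2] [H1 H2]. split.
  - generalize (filter_and _ _ G1 H1). apply filter_imp. intros e [[Ga Gb] [Ha Hb]].
    split; apply (ex_RInt_plus (V := R_NormedModule)); assumption.
  - apply (filterlim_ext_loc (fun eps => plus
      (RInt g (x - PI) (x - eps) + RInt g (x + eps) (x + PI))
      (RInt h (x - PI) (x - eps) + RInt h (x + eps) (x + PI)))).
    + generalize (filter_and _ _ G1 H1). apply filter_imp. intros e [[Ga Gb] [Ha Hb]].
      rewrite !(RInt_plus (V := R_CompleteNormedModule)) by assumption.
      unfold plus; simpl. ring.
    + eapply filterlim_comp_2; [exact G2 | exact H2 |].
      apply (filterlim_plus (V := R_NormedModule) l m).
Qed.

Lemma is_pv_nonpos (g : R -> R) (x l : R) :
  (forall y, g y <= 0) -> is_pv g x l -> l <= 0.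
Proof.
  intros Hg [H1 H2].
  apply (filterlim_le (F := at_right 0)
    (fun eps => RInt g (x - PI) (x - eps) + RInt g (x + eps) (x + PI)) (fun _ => 0) l 0).
  - generalize (filter_and _ _ H1 at_right_0_PI). apply filter_imp.
    intros e [[Ha Hb] He].
    assert (forall a b, a <= b -> ex_RInt g a b -> RInt g a b <= 0) as Hle.
    { intros a b Hab Hex.
      replace 0 with (RInt (fun _ => 0) a b).
      - apply RInt_le; auto. apply ex_RInt_const.
      - rewrite RInt_const. unfold scal; simpl. unfold mult; simpl. ring. }
    generalize (Hle (x - PI) (x - e)) (Hle (x + e) (x + PI)). intros K1 K2.
    assert (RInt g (x - PI) (x - e) <= 0) by (apply K1; [lra | auto]).
    assert (RInt g (x + e) (x + PI) <= 0) by (apply K2; [lra | auto]). lra.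
  - exact H2.
  - apply filterlim_const.
Qed.

Lemma is_Hilbert_unique (f : R -> R) (x l m : R) :
  is_Hilbert f x l -> is_Hilbert f x m -> l = m.
Proof.
  intros [I [HI ->]] [J [HJ ->]]. now rewrite (is_pv_unique _ _ _ _ HI HJ).
Qed.

Lemma is_half_Laplacian_unique (f : R -> R) (x l m : R) :
  is_half_Laplacian f x l -> is_half_Laplacian f x m -> l = m.
Proof.
  intros [I [HI ->]] [J [HJ ->]]. now rewrite (is_pv_unique _ _ _ _ HI HJ).
Qed.

Lemma is_Hilbert_ext (f g : R -> R) (x l : R) :
  (forall y, f y = g y) -> is_Hilbert f x l -> is_Hilbert g x l.
Proof.
  intros E [I [HI Hl]]. exists I. split; [|exact Hl].
  eapply is_pv_ext; [|exact HI]. intros y; simpl. now rewrite E.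
Qed.

Lemma is_half_Laplacian_ext (f g : R -> R) (x l : R) :
  (forall y, f y = g y) -> is_half_Laplacian f x l -> is_half_Laplacian g x l.
Proof.
  intros E [I [HI Hl]]. exists I. split; [|exact Hl].
  eapply is_pv_ext; [|exact HI]. intros y; simpl. now rewrite !E.
Qed.

Lemma is_Hilbert_plus (f g : R -> R) (x l m : R) :
  is_Hilbert f x l -> is_Hilbert g x m -> is_Hilbert (fun y => f y + g y) x (l + m).
Proof.
  intros [I [HI ->]] [J [HJ ->]]. exists (I + J). split; [|ring].
  eapply is_pv_ext; [|apply (is_pv_plus _ _ _ _ _ HI HJ)].
  intros y; unfold Rdiv; ring.
Qed.

Lemma is_half_Laplacian_plus (f g : R -> R) (x l m : R) :
  is_half_Laplacian f x l -> is_half_Laplacian g x m ->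
  is_half_Laplacian (fun y => f y + g y) x (l + m).
Proof.
  intros [I [HI ->]] [J [HJ ->]]. exists (I + J). split; [|ring].
  eapply is_pv_ext; [|apply (is_pv_plus _ _ _ _ _ HI HJ)].
  intros y; unfold Rdiv; ring.
Qed.

(** The integrand has a nonnegative denominator and, at a minimum point, a nonpositive numerator.
    This is the nonlocal form of the minimum principle. *)
Lemma half_Laplacian_nonpos_at_min (f : R -> R) (x l : R) :
  (forall y, f x <= f y) -> is_half_Laplacian f x l -> l <= 0.
Proof.
  intros Hmin [I [HI ->]].
  assert (I <= 0).
  { eapply is_pv_nonpos; [|exact HI]. intros y; simpl.
    specialize (Hmin y).
    set (u := sin ((x - y) / 2)).
    destruct (Req_dec u 0) as [-> | Hu].
    (* Where the sine vanishes the integrand has the default value [0], by [/ 0 = 0]. *)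
    - unfold Rdiv. replace (4 * (0 * (0 * 1))) with 0 by ring. rewrite Rinv_0. lra.
    - assert (0 < 4 * (u * (u * 1))) by (assert (0 < u * u) by (apply Rsqr_pos_lt; exact Hu); lra).
      assert (0 < / (4 * (u * (u * 1)))) by (apply Rinv_0_lt_compat; lra).
      unfold Rdiv. nra. }
  assert (0 < / PI) by (apply Rinv_0_lt_compat, PI_RGT_0). nra.
Qed.

Lemma sin_half_pos (s : R) : 0 < s <= PI -> 0 < sin (s / 2).
Proof. intros H. apply sin_gt_0; pose proof PI_RGT_0; lra. Qed.

Lemma sin_half_neq_0 (x y : R) : 0 < Rabs (y - x) <= PI -> sin ((x - y) / 2) <> 0.
Proof.
  intros H. unfold Rabs in H. destruct (Rcase_abs (y - x)) as [Hn | Hp].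
  - apply Rgt_not_eq. apply sin_half_pos. lra.
  - replace ((x - y) / 2) with (- ((y - x) / 2)) by field. rewrite sin_neg.
    assert (0 < sin ((y - x) / 2)) by (apply sin_half_pos; lra). lra.
Qed.

(* No side condition, as [/ 0 = 0]: at the antipodal point [u = PI / 2] both sides
   are [0], the tangent there being the junk value [1 / 0]. *)
Lemma Hilbert_kernel (z u : R) : z / (2 * tan u) = z * cos u / (2 * sin u).
Proof. unfold tan, Rdiv. rewrite !Rinv_mult, Rinv_inv. ring. Qed.

(** The identity [(sin((n+1)s) - sin(n s)) cot(s/2) = cos(n s) + cos((n+1)s)] removes the
    singularity step by step, from [sin s cot(s/2) = 1 + cos s]. The sines added to [Phi] vanish at
    0 and [PI], so its increment remains [PI]. *)
Lemma Hilbert_antiderivative (k : nat) :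
  exists Phi : R -> R,
    (forall s, 0 < s <= PI ->
       is_derive Phi s (sin (INR (S k) * s) * cos (s / 2) / sin (s / 2))) /\
    continuous Phi 0 /\ Phi PI - Phi 0 = PI.
Proof.
  induction k as [|k [Phi [Hd [Hc HPhi]]]].
  - exists (fun s => s + sin s). split; [|split].
    + intros s Hs. pose proof (sin_half_pos s Hs) as Hsin.
      auto_derive; [exact I|]. simpl INR.
      replace (1 * s) with (2 * (s / 2)) by field.
      replace (cos s) with (cos (2 * (s / 2))) by (f_equal; field).
      rewrite sin_2a, cos_2a_cos. field. lra.
    + apply (ex_derive_continuous (V := R_NormedModule)). auto_derive; exact I.
    + rewrite sin_PI, sin_0. ring.
  - set (n := INR (S k)) in *.
    assert (Hn : 0 < n) by (apply lt_0_INR; lia).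
    exists (fun s => Phi s + (sin (n * s) / n + sin ((n + 1) * s) / (n + 1))).
    rewrite S_INR. fold n. split; [|split].
    + intros s Hs. pose proof (sin_half_pos s Hs) as Hsin.
      evar_last.
      * apply (is_derive_plus (V := R_NormedModule)); [apply Hd, Hs|].
        auto_derive; [exact I | reflexivity].
      * unfold plus; simpl.
        replace ((n + 1) * s) with (n * s + 2 * (s / 2)) by field.
        rewrite cos_plus, sin_plus, sin_2a, cos_2a_sin.
        assert (E : cos (s / 2) * cos (s / 2) = 1 - sin (s / 2) * sin (s / 2))
          by (generalize (sin2_cos2 (s / 2)); unfold Rsqr; lra).
        field_simplify; [|lra|lra].
        replace (cos (s / 2) ^ 2) with (1 - sin (s / 2) * sin (s / 2)) by (rewrite <- E; ring).
        field. lra.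
    + apply (continuous_plus (V := R_NormedModule)); [exact Hc|].
      apply (ex_derive_continuous (V := R_NormedModule)). auto_derive; exact I.
    + rewrite !Rmult_0_r, sin_0.
      replace (sin (n * PI)) with 0.
      * replace (sin ((n + 1) * PI)) with 0; [unfold Rdiv; lra|].
        unfold n. rewrite <- S_INR, INR_IZR_INZ. symmetry. apply sin_eq_0_1. eauto.
      * unfold n. rewrite INR_IZR_INZ. symmetry. apply sin_eq_0_1. eauto.
Qed.

(** The integrand is the Dirichlet kernel [1 + 2 cos s + ... + 2 cos(k s)]: each step adds
    [2 cos(n s)], of integral 0 over [[0, PI]]. *)
Lemma Dirichlet_antiderivative (k : nat) :
  exists Phi : R -> R,
    (forall s, 0 < s <= PI ->
       is_derive Phi s (sin (INR k * s + s / 2) / sin (s / 2))) /\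
    continuous Phi 0 /\ Phi PI - Phi 0 = PI.
Proof.
  induction k as [|k [Phi [Hd [Hc HPhi]]]].
  - exists (fun s => s). split; [|split].
    + intros s Hs. pose proof (sin_half_pos s Hs) as Hsin.
      auto_derive; [exact I|]. simpl INR. rewrite Rmult_0_l, Rplus_0_l. field. lra.
    + apply continuous_id.
    + ring.
  - set (n := INR (S k)).
    assert (Hn : 0 < n) by (apply lt_0_INR; lia).
    exists (fun s => Phi s + 2 * sin (n * s) / n). split; [|split].
    + intros s Hs. pose proof (sin_half_pos s Hs) as Hsin.
      evar_last.
      * apply (is_derive_plus (V := R_NormedModule)); [apply Hd, Hs|].
        auto_derive; [exact I | reflexivity].
      * unfold plus; simpl.
        replace (INR k * s + s / 2) with (n * s - s / 2) by (unfold n; rewrite S_INR; field).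
        rewrite sin_minus, sin_plus. field. lra.
    + apply (continuous_plus (V := R_NormedModule)); [exact Hc|].
      apply (ex_derive_continuous (V := R_NormedModule)). auto_derive; exact I.
    + rewrite !Rmult_0_r, sin_0.
      replace (sin (n * PI)) with 0; [unfold Rdiv; lra|].
      unfold n. rewrite INR_IZR_INZ. symmetry. apply sin_eq_0_1. eauto.
Qed.

(** The integrand is [k] times the Fejer kernel, the sum of the first [k] Dirichlet kernels. Each of
    them contributes [PI], which is the origin of the multiplier [k]. *)
Lemma half_Laplacian_antiderivative (k : nat) :
  exists Phi : R -> R,
    (forall s, 0 < s <= PI ->
       is_derive Phi s ((1 - cos (INR k * s)) / (2 * sin (s / 2) ^ 2))) /\
    continuous Phi 0 /\ Phi PI - Phi 0 = INR k * PI.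
Proof.
  induction k as [|k [Phi [Hd [Hc HPhi]]]].
  - exists (fun _ => 0). split; [|split].
    + intros s Hs. evar_last; [apply (is_derive_const (V := R_NormedModule))|].
      simpl INR. rewrite Rmult_0_l, cos_0. unfold zero, Rdiv; simpl. ring.
    + apply continuous_const.
    + simpl; ring.
  - destruct (Dirichlet_antiderivative k) as [Psi [Hd' [Hc' HPsi]]].
    exists (fun s => Phi s + Psi s). split; [|split].
    + intros s Hs. pose proof (sin_half_pos s Hs) as Hsin.
      evar_last; [apply (is_derive_plus (V := R_NormedModule)); [apply Hd, Hs | apply Hd', Hs]|].
      unfold plus; simpl plus. rewrite S_INR.
      replace ((INR k + 1) * s) with (INR k * s + 2 * (s / 2)) by field.
      change ((1 - cos (INR k * s)) / (2 * sin (s / 2) ^ 2) + sin (INR k * s + s / 2) / sin (s / 2) =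
       (1 - cos (INR k * s + 2 * (s / 2))) / (2 * sin (s / 2) ^ 2)).
      rewrite cos_plus, sin_plus, sin_2a, cos_2a_sin. field. lra.
    + apply (continuous_plus (V := R_NormedModule)); assumption.
    + rewrite S_INR. lra.
Qed.

(** * Waves and trigonometric polynomials *)

Definition wave (a : C) (k : nat) (x : R) : R := Re (a * expi (INR k * x)).

(** Separates the even and the odd part in the shift [s]. After folding, the Hilbert kernel sees
    only the odd part and the half-Laplacian only the even one. *)
Lemma wave_shift (a : C) (k : nat) (x s : R) :
  wave a k (x + s) = Re (a * expi (INR k * x)) * cos (INR k * s)
                     - Im (a * expi (INR k * x)) * sin (INR k * s).
Proof.
  unfold wave. rewrite Rmult_plus_distr_l, expi_plus, Cmult_assoc, re_mult.
  reflexivity.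
Qed.

Lemma wave_shift_neg (a : C) (k : nat) (x s : R) :
  wave a k (x - s) = Re (a * expi (INR k * x)) * cos (INR k * s)
                     + Im (a * expi (INR k * x)) * sin (INR k * s).
Proof.
  replace (x - s) with (x + - s) by ring. rewrite wave_shift.
  rewrite Ropp_mult_distr_r_reverse, cos_neg, sin_neg. ring.
Qed.

Lemma is_derive_wave (a : C) (k : nat) (x : R) :
  is_derive (wave a k) x (- INR k * Im (a * expi (INR k * x))).
Proof.
  apply (is_derive_ext (fun y => fst a * cos (INR k * y) - snd a * sin (INR k * y))).
  - intros t. unfold wave, expi, Re; simpl. ring.
  - auto_derive; [exact I|]. unfold Im; simpl. ring.
Qed.

Lemma continuous_wave (a : C) (k : nat) (x : R) : continuous (wave a k) x.
Proof.
  apply (ex_derive_continuous (V := R_NormedModule)). eexists. apply is_derive_wave.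
Qed.

Lemma is_Hilbert_const (a x : R) : is_Hilbert (fun _ => a) x 0.
Proof.
  exists 0. split; [|ring].
  (* The form [cos / sin] is continuous at the antipodal points, where [tan] is undefined;
     [is_pv_intro] asks for continuity there. *)
  apply (is_pv_ext (fun y => a * cos ((x - y) / 2) / (2 * sin ((x - y) / 2)))).
  { intros y. now rewrite Hilbert_kernel. }
  evar_last; [apply (is_pv_intro _ (fun _ => 0)) | ring].
  - intros y Hy. apply (ex_derive_continuous (V := R_NormedModule)).
    pose proof (sin_half_neq_0 x y Hy). unfold Rdiv in *. auto_derive. unfold Rminus, Rdiv in *. lra.
  - intros s Hs. evar_last; [apply (is_derive_const (V := R_NormedModule))|].
    replace ((x - (x - s)) / 2) with (s / 2) by field.
    replace ((x - (x + s)) / 2) with (- (s / 2)) by field.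
    rewrite cos_neg, sin_neg. pose proof (sin_half_pos s Hs). unfold zero; simpl. field. lra.
  - apply continuous_const.
Qed.

(** The frequency is a successor because the multiplier of the Hilbert transform jumps at 0: for
    [k = 0] the formula would give [Im a] instead of 0. *)
Lemma is_Hilbert_wave (a : C) (k : nat) (x : R) :
  is_Hilbert (wave a (S k)) x (Im (a * expi (INR (S k) * x))).
Proof.
  destruct (Hilbert_antiderivative k) as [Phi [Hd [Hc HPhi]]].
  set (q := Im _). exists (q * Phi PI - q * Phi 0). split.
  - apply (is_pv_ext (fun y => wave a (S k) y * cos ((x - y) / 2) / (2 * sin ((x - y) / 2)))).
    { intros y. now rewrite Hilbert_kernel. }
    apply (is_pv_intro _ (fun s => q * Phi s)).
    + intros y Hy. pose proof (sin_half_neq_0 x y Hy).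
      apply (continuous_ext (fun y => mult (wave a (S k) y) (cos ((x - y) / 2) / (2 * sin ((x - y) / 2))))).
      { intros. unfold mult; simpl. unfold Rdiv. ring. }
      apply (continuous_mult (K := R_AbsRing)); [apply continuous_wave|].
      apply (ex_derive_continuous (V := R_NormedModule)).
      unfold Rdiv in *. auto_derive. unfold Rminus, Rdiv in *. lra.
    + intros s Hs. evar_last; [apply is_derive_scal, Hd, Hs|].
      rewrite wave_shift, wave_shift_neg. fold q.
      replace ((x - (x - s)) / 2) with (s / 2) by field.
      replace ((x - (x + s)) / 2) with (- (s / 2)) by field.
      rewrite cos_neg, sin_neg. pose proof (sin_half_pos s Hs). field. lra.
    + apply (continuous_scal_r (V := R_NormedModule) q Phi), Hc.
  - pose proof PI_RGT_0. replace (q * Phi PI - q * Phi 0) with (q * PI) by (rewrite <- Rmult_minus_distr_l, HPhi; ring).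
    field. lra.
Qed.

Lemma is_half_Laplacian_wave (a : C) (k : nat) (x : R) :
  is_half_Laplacian (wave a k) x (INR k * wave a k x).
Proof.
  destruct (half_Laplacian_antiderivative k) as [Phi [Hd [Hc HPhi]]].
  set (p := wave a k x). exists (p * Phi PI - p * Phi 0). split.
  - apply (is_pv_intro _ (fun s => p * Phi s)).
    + intros y Hy. pose proof (sin_half_neq_0 x y Hy) as Hs.
      apply (continuous_ext (fun y => mult (p - wave a k y) (/ (4 * sin ((x - y) / 2) ^ 2)))).
      { reflexivity. }
      apply (continuous_mult (K := R_AbsRing)).
      * apply (continuous_minus (V := R_NormedModule)); [apply continuous_const | apply continuous_wave].
      * apply (ex_derive_continuous (V := R_NormedModule)).
        auto_derive. unfold Rminus, Rdiv in *.
        intros E. apply Hs.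
        assert (E' : Rsqr (sin ((x + - y) * / 2)) = 0) by (unfold Rsqr; lra).
        now apply Rsqr_0_uniq in E'.
    + intros s Hs. evar_last; [apply is_derive_scal, Hd, Hs|].
      rewrite wave_shift, wave_shift_neg. fold (wave a k x). fold p.
      replace ((x - (x - s)) / 2) with (s / 2) by field.
      replace ((x - (x + s)) / 2) with (- (s / 2)) by field.
      rewrite sin_neg. pose proof (sin_half_pos s Hs). field. lra.
    + apply (continuous_scal_r (V := R_NormedModule) p Phi), Hc.
  - pose proof PI_RGT_0. replace (p * Phi PI - p * Phi 0) with (p * (INR k * PI)) by (rewrite <- Rmult_minus_distr_l, HPhi; ring).
    field. lra.
Qed.

Lemma is_half_Laplacian_const (a x : R) : is_half_Laplacian (fun _ => a) x 0.
Proof.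
  evar_last.
  - apply (is_half_Laplacian_ext (wave (RtoC a) 0)); [|apply is_half_Laplacian_wave].
    intros y. unfold wave; simpl. rewrite Rmult_0_l, cos_0. ring.
  - simpl; ring.
Qed.

(* [tp K c] is the real part of [c 0 + 2 * sum_(1 <= k <= K) c k exp(i k x)]: the
   trigonometric polynomial whose Fourier coefficients are [Re (c 0)] at [0],
   [c k] at [k > 0] and [Cconj (c (-k))] at [k < 0]. *)
Definition tp (K : nat) (c : nat -> C) (x : R) : R :=
  Re (c 0%nat) + 2 * Re (csum (fun k => c k * expi (INR k * x))%C K).

(** The right-hand side of [Fourier_ODE] on the frequencies [n >= 0] alone; the negative ones are
    conjugates and are not part of the state. *)
Definition coef_rhs (K : nat) (c : nat -> C) (n : nat) : C :=
  (- (RtoC (INR n) * c 0%nat * c n)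
   - csum (fun j => RtoC (2 * (INR n + 2 * INR j)) * c (n + j)%nat * Cconj (c j)) K)%C.

Lemma tp_0 (c : nat -> C) (x : R) : tp 0 c x = Re (c 0%nat).
Proof. unfold tp. rewrite csum_0. simpl. ring. Qed.

Lemma tp_S (K : nat) (c : nat -> C) (x : R) :
  tp (S K) c x = tp K c x + wave (2 * c (S K)) (S K) x.
Proof.
  unfold tp, wave. rewrite csum_S, <- Cmult_assoc, re_scal_l, re_plus. ring.
Qed.

Lemma tp_ext (K : nat) (c d : nat -> C) (x : R) :
  (forall k, (k <= K)%nat -> c k = d k) -> tp K c x = tp K d x.
Proof.
  intros H. unfold tp. rewrite (H 0%nat) by lia. do 3 f_equal.
  apply csum_ext. intros k Hk. now rewrite H by lia.
Qed.

Lemma continuous_tp (K : nat) (c : nat -> C) (x : R) : continuous (tp K c) x.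
Proof.
  induction K as [|K IH].
  - apply (continuous_ext (fun _ => Re (c 0%nat))).
    + intros; now rewrite tp_0.
    + apply continuous_const.
  - eapply continuous_ext; [intros; symmetry; apply tp_S|].
    apply (continuous_plus (V := R_NormedModule)); [exact IH | apply continuous_wave].
Qed.

Lemma periodic_tp (K : nat) (c : nat -> C) : periodic (tp K c).
Proof.
  intros x. unfold tp. do 3 f_equal. apply csum_ext. intros k _.
  now rewrite expi_periodic.
Qed.

Lemma Re_2_mult (z : C) : Re (2 * z) = 2 * Re z.
Proof. apply (re_scal_l 2 z). Qed.

Lemma Im_2_mult (z : C) : Im (2 * z) = 2 * Im z.
Proof. apply (im_scal_l 2 z). Qed.

Lemma is_derive_tp (K : nat) (c : nat -> C) (x : R) :
  is_derive (tp K c) x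
    (-2 * Im (csum (fun k => RtoC (INR k) * (c k * expi (INR k * x)))%C K)).
Proof.
  induction K as [|K IH].
  - apply (is_derive_ext (fun _ => Re (c 0%nat))); [intros; now rewrite tp_0|].
    evar_last; [apply (is_derive_const (V := R_NormedModule))|].
    rewrite csum_0. unfold zero; simpl. ring.
  - apply (is_derive_ext (fun y => tp K c y + wave (2 * c (S K)) (S K) y));
      [intros; now rewrite tp_S|].
    evar_last; [apply (is_derive_plus (V := R_NormedModule)); [exact IH | apply is_derive_wave]|].
    rewrite csum_S, im_plus, im_scal_l, <- Cmult_assoc, Im_2_mult.
    unfold plus; cbn -[INR]. ring.
Qed.

Lemma is_Hilbert_tp (K : nat) (c : nat -> C) (x : R) :
  is_Hilbert (tp K c) x (2 * Im (csum (fun k => c k * expi (INR k * x))%C K)).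
Proof.
  induction K as [|K IH].
  - apply (is_Hilbert_ext (fun _ => Re (c 0%nat))); [intros; now rewrite tp_0|].
    rewrite csum_0. simpl Im. rewrite Rmult_0_r. apply is_Hilbert_const.
  - apply (is_Hilbert_ext (fun y => tp K c y + wave (2 * c (S K)) (S K) y));
      [intros; now rewrite tp_S|].
    evar_last; [apply is_Hilbert_plus; [exact IH | apply is_Hilbert_wave]|].
    rewrite csum_S, im_plus, <- Cmult_assoc, Im_2_mult. ring.
Qed.

Lemma is_half_Laplacian_tp (K : nat) (c : nat -> C) (x : R) :
  is_half_Laplacian (tp K c) x
    (2 * Re (csum (fun k => RtoC (INR k) * (c k * expi (INR k * x)))%C K)).
Proof.
  induction K as [|K IH].
  - apply (is_half_Laplacian_ext (fun _ => Re (c 0%nat))); [intros; now rewrite tp_0|].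
    rewrite csum_0. simpl Re. rewrite Rmult_0_r. apply is_half_Laplacian_const.
  - apply (is_half_Laplacian_ext (fun y => tp K c y + wave (2 * c (S K)) (S K) y));
      [intros; now rewrite tp_S|].
    evar_last; [apply is_half_Laplacian_plus; [exact IH | apply is_half_Laplacian_wave]|].
    unfold wave.
    rewrite csum_S, re_plus, re_scal_l, <- Cmult_assoc, Re_2_mult. ring.
Qed.

Lemma expi_mult_conj (a : R) : (expi a * Cconj (expi a))%C = 1%C.
Proof.
  rewrite <- expi_opp, <- expi_plus, Rplus_opp_r. apply expi_0.
Qed.

(* With [z = exp(i x)], [A = sum c_k z^k] and [B = sum k c_k z^k], the sum
   [A conj(B) + B conj(A)] is the double sum of [(i + j) c_i conj(c_j) z^(i - j)],
   which is then collected along the diagonals [i - j = d]. *)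
Lemma tp_coef_rhs (K : nat) (c : nat -> C) (x : R) :
  Im (c 0%nat) = 0 -> (forall k, (K < k)%nat -> c k = 0%C) ->
  2 * Im (csum (fun k => c k * expi (INR k * x))%C K)
    * (-2 * Im (csum (fun k => RtoC (INR k) * (c k * expi (INR k * x)))%C K))
  - tp K c x * (2 * Re (csum (fun k => RtoC (INR k) * (c k * expi (INR k * x)))%C K))
  = tp K (coef_rhs K c) x.
Proof.
  intros H0 HK.
  set (e := fun k => expi (INR k * x)).
  set (A := csum (fun k => c k * expi (INR k * x))%C K).
  set (B := csum (fun k => RtoC (INR k) * (c k * expi (INR k * x)))%C K).
  set (S := csum (fun d => csum (fun j =>
     RtoC (INR d + 2 * INR j) * c (d + j)%nat * Cconj (c j)) K * e d)%C K).
  set (Q := csum (fun j => RtoC (INR j) * c j * Cconj (c j))%C K).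
  assert (Ediag : (B * Cconj A + A * Cconj B)%C
     = (2 * Q + (S + Cconj S))%C).
  { transitivity (csum (fun i => csum (fun j =>
       RtoC (INR i + INR j) * (c i * e i) * Cconj (c j * e j))%C K) K).
    - unfold A, B. rewrite !csum_conj, <- !csum_mult_r, <- csum_plus.
      apply csum_ext. intros i _. rewrite <- !csum_mult_l, <- csum_plus.
      apply csum_ext. intros j _. unfold e.
      rewrite (Cmult_conj (RtoC (INR j))), RtoC_plus.
      replace (Cconj (INR j)) with (RtoC (INR j)) by (unfold Cconj, RtoC; simpl; f_equal; ring).
      ring.
    - rewrite (csum_square_diagonals (fun i j =>
        RtoC (INR i + INR j) * (c i * e i) * Cconj (c j * e j))%C).
      + f_equal.
        * unfold Q. rewrite <- csum_mult_l. apply csum_ext. intros j _.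
          rewrite Cmult_conj, RtoC_plus.
          transitivity (2 * INR j * c j * Cconj (c j) * (e j * Cconj (e j)))%C; [ring|].
          unfold e. rewrite expi_mult_conj. ring.
        * unfold S. rewrite csum_conj, <- csum_plus. apply csum_ext. intros d _.
          rewrite csum_plus. f_equal.
          -- rewrite <- csum_mult_r. apply csum_ext. intros j _.
             assert (Ee : e (d + j)%nat = (e d * e j)%C).
             { unfold e. rewrite plus_INR, Rmult_plus_distr_r. apply expi_plus. }
             rewrite Ee, Cmult_conj, plus_INR.
             transitivity ((INR d + INR j + INR j)%R * c (d + j)%nat * Cconj (c j) * e d * (e j * Cconj (e j)))%C; [ring|].
             unfold e. rewrite expi_mult_conj.
             replace (INR d + INR j + INR j)%R with (INR d + 2 * INR j)%R by ring. ring.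
          -- rewrite <- csum_mult_r, csum_conj. apply csum_ext. intros j _.
             assert (Ee : e (d + j)%nat = (e d * e j)%C).
             { unfold e. rewrite plus_INR, Rmult_plus_distr_r. apply expi_plus. }
             rewrite Ee, !Cmult_conj, plus_INR, Cconj_conj.
             replace (Cconj (RtoC (INR d + 2 * INR j))) with (RtoC (INR d + 2 * INR j))
               by (unfold Cconj, RtoC; simpl; f_equal; ring).
             transitivity ((INR j + (INR d + INR j))%R * Cconj (c (d + j)%nat) * c j * Cconj (e d) * (e j * Cconj (e j)))%C; [ring|].
             unfold e. rewrite expi_mult_conj.
             replace (INR j + (INR d + INR j))%R with (INR d + 2 * INR j)%R by ring. ring.
      + intros i j [Hi | Hj].
        * rewrite (HK i Hi). ring.
        * rewrite (HK j Hj). replace (Cconj (0 * e j)) with (RtoC 0); [ring|].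
          rewrite Cmult_0_l. unfold Cconj, RtoC; simpl; f_equal; ring. }
  assert (EF0 : coef_rhs K c 0 = (- (4 * Q))%C).
  { unfold coef_rhs, Q. rewrite <- csum_mult_l.
    rewrite (csum_ext (fun j => RtoC (2 * (INR 0 + 2 * INR j)) * c (0 + j)%nat * Cconj (c j))%C
      (fun j => 4 * (INR j * c j * Cconj (c j)))%C).
    - simpl INR. ring.
    - intros j _. replace (2 * (INR 0 + 2 * INR j)) with (4 * INR j) by (simpl; ring).
      rewrite RtoC_mult. change (0 + j)%nat with j. ring. }
  assert (EF : csum (fun k => coef_rhs K c k * expi (INR k * x))%C K
     = (- (c 0%nat * B) - 2 * S)%C).
  { unfold B, S. rewrite <- !csum_mult_l.
    transitivity (csum (fun k => (- (1)) * (c 0%nat * (INR k * (c k * expi (INR k * x)))) +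
      (- (1)) * (2 * (csum (fun j => RtoC (INR k + 2 * INR j) * c (k + j)%nat * Cconj (c j)) K * e k)))%C K).
    - apply csum_ext. intros k _. unfold coef_rhs.
      rewrite (csum_ext (fun j => RtoC (2 * (INR k + 2 * INR j)) * c (k + j)%nat * Cconj (c j))%C
        (fun j => 2 * (RtoC (INR k + 2 * INR j) * c (k + j)%nat * Cconj (c j)))%C).
      + rewrite csum_mult_l. unfold e. ring.
      + intros j _. rewrite (RtoC_mult 2). ring.
    - rewrite csum_plus, !csum_mult_l. ring. }
  unfold tp. rewrite EF, EF0. fold A.
  (* The left-hand side is [-4 (Im A Im B + Re A Re B) - 2 Re (c 0) Re B], and the bracket is half
     of [B conj(A) + A conj(B)]. So the real part of [Ediag] is all that is needed. *)
  apply (f_equal Re) in Ediag.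
  rewrite !re_plus, !re_mult, !re_conj, !im_conj in Ediag.
  unfold Cminus. rewrite re_plus, !re_opp, !re_mult, H0.
  assert (E4 : Im 4 = 0) by reflexivity. assert (E4' : Re 4 = 4) by reflexivity.
  assert (E2 : Im 2 = 0) by reflexivity. assert (E2' : Re 2 = 2) by reflexivity.
  rewrite E4, E4', E2, E2'. rewrite E2, E2' in Ediag. lra.
Qed.

(** * Fourier coefficients *)

Lemma ex_RInt_continuous_all (f : R -> R) (a b : R) :
  (forall x, continuous f x) -> ex_RInt f a b.
Proof.
  intros H. apply (ex_RInt_continuous (V := R_CompleteNormedModule)). auto.
Qed.

Lemma continuous_cos_affine (a b x : R) : continuous (fun y => cos (a * y + b)) x.
Proof. apply (ex_derive_continuous (V := R_NormedModule)). auto_derive; exact I. Qed.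

Lemma continuous_Rmult (f g : R -> R) (x : R) :
  continuous f x -> continuous g x -> continuous (fun y => f y * g y) x.
Proof. intros Hf Hg. exact (continuous_mult (K := R_AbsRing) f g x Hf Hg). Qed.

Lemma continuous_cos_lin (a x : R) : continuous (fun y => cos (a * y)) x.
Proof. apply (ex_derive_continuous (V := R_NormedModule)). auto_derive; exact I. Qed.

Lemma continuous_sin_lin (a x : R) : continuous (fun y => sin (a * y)) x.
Proof. apply (ex_derive_continuous (V := R_NormedModule)). auto_derive; exact I. Qed.

Lemma Fourier_is_RInt (f : R -> R) (k : Z) (l : C) :
  is_RInt (V := C_R_NormedModule) (fun x => RtoC (f x) * expi (- IZR k * x))%C (- PI) PI l ->
  Fourier f k = (RtoC (/ (2 * PI)) * l)%C.
Proof.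
  intros H. unfold Fourier. f_equal.
  exact (is_RInt_unique (V := C_R_CompleteNormedModule) _ _ _ _ H).
Qed.

Lemma is_RInt_Fourier (f : R -> R) (k : Z) :
  (forall x, continuous f x) ->
  is_RInt (V := C_R_NormedModule) (fun x => RtoC (f x) * expi (- IZR k * x))%C (- PI) PI
    (RInt (fun x => f x * cos (IZR k * x)) (- PI) PI,
     - RInt (fun x => f x * sin (IZR k * x)) (- PI) PI).
Proof.
  intros Hf. apply (is_RInt_fct_extend_pair (U := R_NormedModule) (V := R_NormedModule)).
  - apply (is_RInt_ext (fun x => f x * cos (IZR k * x))).
    + intros x _. simpl. rewrite Ropp_mult_distr_l_reverse, cos_neg. ring.
    + apply (RInt_correct (V := R_CompleteNormedModule)), ex_RInt_continuous_all.
      intros x. apply continuous_Rmult; [apply Hf | apply continuous_cos_lin].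
  - apply (is_RInt_ext (fun x => opp (f x * sin (IZR k * x)))).
    + intros x _. simpl. rewrite Ropp_mult_distr_l_reverse, sin_neg. unfold opp; simpl; ring.
    + apply (is_RInt_opp (V := R_NormedModule)).
      apply (RInt_correct (V := R_CompleteNormedModule)), ex_RInt_continuous_all.
      intros x. apply continuous_Rmult; [apply Hf | apply continuous_sin_lin].
Qed.

Lemma Fourier_components (f : R -> R) (k : Z) :
  (forall x, continuous f x) ->
  Fourier f k = (RtoC (/ (2 * PI)) *
    (RInt (fun x => f x * cos (IZR k * x)) (- PI) PI,
     - RInt (fun x => f x * sin (IZR k * x)) (- PI) PI)%R)%C.
Proof. intros Hf. now apply Fourier_is_RInt, is_RInt_Fourier. Qed.

Lemma Fourier_ext (f g : R -> R) (k : Z) :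
  (forall x, f x = g x) -> Fourier f k = Fourier g k.
Proof.
  intros H. unfold Fourier. f_equal. apply RInt_ext. intros x _. now rewrite H.
Qed.

Lemma Fourier_opp_index (f : R -> R) (k : Z) :
  (forall x, continuous f x) -> Fourier f (- k) = Cconj (Fourier f k).
Proof.
  intros Hf. rewrite !Fourier_components by exact Hf.
  rewrite Cmult_conj. f_equal.
  - unfold Cconj, RtoC; simpl; f_equal; ring.
  - unfold Cconj. simpl fst; simpl snd. rewrite Ropp_involutive. f_equal.
    + apply RInt_ext. intros x _.
      now rewrite opp_IZR, Ropp_mult_distr_l_reverse, cos_neg.
    + rewrite <- (RInt_opp (V := R_CompleteNormedModule)).
      * apply RInt_ext. intros x _.
        rewrite opp_IZR, Ropp_mult_distr_l_reverse, sin_neg. unfold opp; simpl; ring.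
      * apply ex_RInt_continuous_all. intros x.
        apply continuous_Rmult; [apply Hf | apply continuous_sin_lin].
Qed.

Lemma Fourier_0_real (h : R -> R) : (forall x, continuous h x) -> Im (Fourier h 0) = 0.
Proof.
  intros Hc. pose proof (Fourier_opp_index h 0 Hc) as E. apply (f_equal Im) in E.
  rewrite im_conj in E. simpl Z.opp in E. lra.
Qed.

Lemma Fourier_plus (f g : R -> R) (k : Z) :
  (forall x, continuous f x) -> (forall x, continuous g x) ->
  Fourier (fun x => f x + g x) k = (Fourier f k + Fourier g k)%C.
Proof.
  intros Hf Hg. rewrite (Fourier_components f), (Fourier_components g) by assumption.
  rewrite <- Cmult_plus_distr_l. apply Fourier_is_RInt.
  eapply is_RInt_ext; [|exact (is_RInt_plus _ _ _ _ _ _ (is_RInt_Fourier f k Hf) (is_RInt_Fourier g k Hg))].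
  intros x _. cbv beta. rewrite RtoC_plus. symmetry. apply Cmult_plus_distr_r.
Qed.

Lemma Fourier_scal (r : R) (f : R -> R) (k : Z) :
  (forall x, continuous f x) ->
  Fourier (fun x => r * f x) k = (RtoC r * Fourier f k)%C.
Proof.
  intros Hf. rewrite (Fourier_components f) by assumption.
  rewrite Cmult_assoc, (Cmult_comm r), <- Cmult_assoc, <- (scal_R_Cmult r).
  apply Fourier_is_RInt.
  eapply is_RInt_ext; [|exact (is_RInt_scal _ _ _ r _ (is_RInt_Fourier f k Hf))].
  intros x _. cbv beta. rewrite scal_R_Cmult, RtoC_mult. match goal with |- ?u = ?v => change (@eq C u v) end. ring.
Qed.

Lemma sin_IZR_PI (n : Z) : sin (IZR n * PI) = 0.
Proof. apply sin_eq_0_1. now exists n. Qed.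

Lemma is_RInt_expi (a : C) (n : Z) :
  is_RInt (V := C_R_NormedModule) (fun x => a * expi (IZR n * x))%C (- PI) PI
    (if Z.eq_dec n 0 then (2 * PI)%R * a else RtoC 0)%C.
Proof.
  destruct (Z.eq_dec n 0) as [-> | Hn].
  - eapply is_RInt_ext; [|evar_last; [apply (is_RInt_const (V := C_R_NormedModule) (- PI) PI a)|]].
    + intros x _. rewrite Rmult_0_l, expi_0. symmetry. apply Cmult_1_r.
    + rewrite scal_R_Cmult. f_equal. f_equal. ring.
  - assert (Hn' : IZR n <> 0) by (apply eq_IZR_contrapositive; exact Hn).
    (* This is [a exp(i n x) / (i n)] in components; it takes the same value at [PI] and [- PI]. *)
    set (Phi := fun x => (a * (sin (IZR n * x) / IZR n, - cos (IZR n * x) / IZR n)%R)%C).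
    replace (RtoC 0) with (minus (Phi PI) (Phi (- PI))).
    + apply (is_RInt_fct_extend_pair (U := R_NormedModule) (V := R_NormedModule)).
      * apply (is_RInt_derive (V := R_CompleteNormedModule) (fun x => fst (Phi x))).
        -- intros x _. unfold Phi; simpl. auto_derive; [exact I|]. field. exact Hn'.
        -- intros x _. apply (ex_derive_continuous (V := R_NormedModule)). simpl.
           auto_derive; exact I.
      * apply (is_RInt_derive (V := R_CompleteNormedModule) (fun x => snd (Phi x))).
        -- intros x _. unfold Phi; simpl. auto_derive; [exact I|]. field. exact Hn'.
        -- intros x _. apply (ex_derive_continuous (V := R_NormedModule)). simpl.
           auto_derive; exact I.
    + unfold Phi. rewrite Ropp_mult_distr_r_reverse, sin_neg, cos_neg, sin_IZR_PI.
      rewrite Ropp_0. apply (minus_eq_zero (G := C_R_NormedModule)).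
Qed.

(** A real wave is the half-sum of two conjugate exponentials. For [m = k = 0] both cases apply and
    add up to [Re a]. *)
Lemma Fourier_wave (a : C) (m : nat) (k : Z) :
  Fourier (wave a m) k =
   ((if Z.eq_dec (Z.of_nat m - k) 0 then a / 2 else 0)
    + (if Z.eq_dec (- Z.of_nat m - k) 0 then Cconj a / 2 else 0))%C.
Proof.
  erewrite Fourier_is_RInt.
  2: { eapply is_RInt_ext; [|exact (is_RInt_plus _ _ _ _ _ _
    (is_RInt_expi (a / 2) (Z.of_nat m - k)) (is_RInt_expi (Cconj a / 2) (- Z.of_nat m - k)))].
    intros x _. unfold wave.
    rewrite re_alt, Cmult_conj, <- expi_opp.
    rewrite !minus_IZR, opp_IZR, <- INR_IZR_INZ.
    replace ((INR m - IZR k) * x) with (INR m * x + (- IZR k * x)) by ring.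
    replace ((- INR m - IZR k) * x) with (- (INR m * x) + (- IZR k * x)) by ring.
    rewrite !expi_plus.
    match goal with |- plus ?p ?q = ?r => change ((p + q)%C = r) end.
    unfold Cdiv. ring. }
  match goal with |- (_ * plus ?p ?q)%C = _ => change (RtoC (/ (2 * PI)) * (p + q) =
    ((if Z.eq_dec (Z.of_nat m - k) 0 then a / 2 else 0)
      + (if Z.eq_dec (- Z.of_nat m - k) 0 then Cconj a / 2 else 0)))%C end.
  pose proof PI_RGT_0.
  assert (E : forall z : C, (RtoC (/ (2 * PI)) * ((2 * PI)%R * z))%C = z).
  { intros z. rewrite Cmult_assoc, <- RtoC_mult, Rinv_l by lra. apply Cmult_1_l. }
  rewrite Cmult_plus_distr_l. f_equal;
  match goal with |- context [Z.eq_dec ?u ?v] => destruct (Z.eq_dec u v) end;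
  try apply E; apply Cmult_0_r.
Qed.

Lemma Fourier_tp (K : nat) (c : nat -> C) (n : nat) :
  Fourier (tp K c) (Z.of_nat n) =
    if Nat.eq_dec n 0 then RtoC (Re (c 0%nat))
    else if le_dec n K then c n else 0%C.
Proof.
  induction K as [|K IH].
  - rewrite (Fourier_ext _ (wave (RtoC (Re (c 0%nat))) 0)).
    + rewrite Fourier_wave. destruct (Nat.eq_dec n 0) as [-> | Hn].
      * simpl. replace (Cconj (Re (c 0%nat))) with (RtoC (Re (c 0%nat)))
          by (unfold Cconj, RtoC; simpl; f_equal; ring). field.
      * repeat match goal with |- context [Z.eq_dec ?u ?v] => destruct (Z.eq_dec u v); [lia|] end.
        destruct (le_dec n 0); [lia|]. ring.
    + intros x. rewrite tp_0. unfold wave. simpl INR.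
      rewrite Rmult_0_l, expi_0, Cmult_1_r. reflexivity.
  - rewrite (Fourier_ext _ (fun x => tp K c x + wave (2 * c (S K)) (S K) x))
      by (intros; apply tp_S).
    rewrite Fourier_plus by (intros; first [apply continuous_tp | apply continuous_wave]).
    rewrite IH, Fourier_wave.
    destruct (Z.eq_dec (- Z.of_nat (S K) - Z.of_nat n) 0); [lia|].
    destruct (Nat.eq_dec n 0) as [-> | Hn].
    + destruct (Z.eq_dec _ _); [lia|]. ring.
    + destruct (Z.eq_dec _ _).
      * replace n with (S K) by lia.
        destruct (le_dec (S K) K); [lia|]. destruct (le_dec (S K) (S K)); [|lia].
        field.
      * destruct (le_dec n K); destruct (le_dec n (S K)); try lia; ring.
Qed.

(** * Injectivity of the Fourier coefficients on continuous periodic functions *)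

Lemma periodic_IZR (f : R -> R) (n : Z) (x : R) :
  periodic f -> f (x + 2 * PI * IZR n) = f x.
Proof.
  intros Hf. revert x.
  assert (Hnat : forall (m : nat) x, f (x + 2 * PI * INR m) = f x).
  { induction m as [|m IH]; intros x.
    - simpl. now rewrite Rmult_0_r, Rplus_0_r.
    - rewrite S_INR. replace (x + 2 * PI * (INR m + 1)) with (x + 2 * PI * INR m + 2 * PI) by ring.
      now rewrite Hf. }
  intros x. destruct (Z_le_dec 0 n).
  - rewrite <- (Z2Nat.id n) by lia. rewrite <- INR_IZR_INZ. apply Hnat.
  - rewrite <- (Hnat (Z.to_nat (- n))).
    rewrite INR_IZR_INZ, Z2Nat.id by lia. rewrite opp_IZR. f_equal. ring.
Qed.

Lemma periodic_representative (f : R -> R) (x : R) :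
  periodic f -> exists y, - PI <= y < PI /\ f x = f y.
Proof.
  intros Hf. pose proof PI_RGT_0 as HPI.
  set (r := (x + PI) / (2 * PI)).
  exists (x + 2 * PI * IZR (- Int_part r)). split; [|now rewrite periodic_IZR].
  destruct (base_Int_part r) as [H1 H2].
  assert (Hx : x = 2 * PI * r - PI) by (unfold r; field; lra).
  rewrite opp_IZR, Hx. nra.
Qed.

Lemma periodic_continuous_min (f : R -> R) :
  periodic f -> (forall x, continuous f x) -> exists x0, forall x, f x0 <= f x.
Proof.
  intros Hp Hc. pose proof PI_RGT_0.
  destruct (continuity_ab_min f (- PI) PI) as [x0 [Hmin _]].
  - lra.
  - intros c _. apply continuity_pt_filterlim, Hc.
  - exists x0. intros x. destruct (periodic_representative f x Hp) as [y [Hy ->]].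
    apply Hmin. lra.
Qed.

Lemma periodic_continuous_bounded (f : R -> R) :
  periodic f -> (forall x, continuous f x) -> exists M, 0 < M /\ forall x, Rabs (f x) <= M.
Proof.
  intros Hp Hc.
  destruct (periodic_continuous_min f Hp Hc) as [x0 H0].
  destruct (periodic_continuous_min (fun x => - f x)) as [x1 H1].
  - intros x. now rewrite Hp.
  - intros x. apply (continuous_opp (V := R_NormedModule) f), Hc.
  - exists (Rabs (f x0) + Rabs (f x1) + 1).
    pose proof (Rabs_pos (f x0)). pose proof (Rabs_pos (f x1)).
    split; [lra|]. intros x. specialize (H0 x). specialize (H1 x).
    pose proof (Rle_abs (f x1)). pose proof (Rle_abs (- f x0)). rewrite Rabs_Ropp in *.
    apply Rabs_le. lra.
Qed.

Lemma pow_unbounded (q c M : R) : 1 < q -> 0 < c -> exists n : nat, M < c * q ^ n.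
Proof.
  intros Hq Hc.
  destruct (nfloor_ex (Rabs M / (c * (q - 1)))) as [n [_ Hn]].
  { apply Rdiv_le_0_compat; [apply Rabs_pos | nra]. }
  exists (S n).
  (* [poly] is Bernoulli's inequality. *)
  pose proof (poly (S n) (q - 1)) as Hp. rewrite S_INR in Hp.
  replace (1 + (q - 1)) with q in Hp by ring.
  assert (Hp' : 1 + (INR n + 1) * (q - 1) <= q ^ S n) by (apply Hp; lra).
  assert (Rabs M < (INR n + 1) * (c * (q - 1))).
  { apply (Rmult_lt_compat_r (c * (q - 1))) in Hn; [|nra].
    unfold Rdiv in Hn. rewrite Rmult_assoc, Rinv_l, Rmult_1_r in Hn; [exact Hn | nra]. }
  pose proof (Rle_abs M). nra.
Qed.

Lemma is_RInt_lincomb (f g : R -> R) (a b p q If Ig : R) :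
  is_RInt f a b If -> is_RInt g a b Ig ->
  is_RInt (fun x => p * f x + q * g x) a b (p * If + q * Ig).
Proof.
  intros Hf Hg.
  exact (is_RInt_plus _ _ _ _ _ _ (is_RInt_scal _ _ _ p _ Hf) (is_RInt_scal _ _ _ q _ Hg)).
Qed.

Lemma Fourier_zero_cos (h : R -> R) :
  (forall x, continuous h x) -> (forall k, Fourier h k = 0%C) ->
  forall (k : Z) (b : R), RInt (fun x => h x * cos (IZR k * x + b)) (- PI) PI = 0.
Proof.
  intros Hc HF k b. specialize (HF k). rewrite Fourier_components in HF by exact Hc.
  pose proof PI_RGT_0. assert (0 < / (2 * PI)) by (apply Rinv_0_lt_compat; lra).
  set (I1 := RInt (fun x => h x * cos (IZR k * x)) (- PI) PI) in *.
  set (I2 := RInt (fun x => h x * sin (IZR k * x)) (- PI) PI) in *.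
  assert (E1 : I1 = 0).
  { apply (f_equal Re) in HF. rewrite re_scal_l in HF. simpl in HF. nra. }
  assert (E2 : I2 = 0).
  { apply (f_equal Im) in HF. rewrite im_scal_l in HF. simpl in HF. nra. }
  apply is_RInt_unique.
  assert (H1 : is_RInt (fun x => h x * cos (IZR k * x)) (- PI) PI 0).
  { rewrite <- E1. apply (RInt_correct (V := R_CompleteNormedModule)), ex_RInt_continuous_all.
    intros x. apply continuous_Rmult; [apply Hc | apply continuous_cos_lin]. }
  assert (H2 : is_RInt (fun x => h x * sin (IZR k * x)) (- PI) PI 0).
  { rewrite <- E2. apply (RInt_correct (V := R_CompleteNormedModule)), ex_RInt_continuous_all.
    intros x. apply continuous_Rmult; [apply Hc | apply continuous_sin_lin]. }
  pose proof (is_RInt_lincomb _ _ _ _ (cos b) (- sin b) _ _ H1 H2) as H3.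
  rewrite !Rmult_0_r, Rplus_0_r in H3.
  revert H3. apply is_RInt_ext. intros x _. rewrite cos_plus. simpl. ring.
Qed.

(** A factor [cos (x - x0)] turns [cos (k x + b)] into the half-sum of the cosines with frequencies
    [k + 1], [k - 1] and phases [b - x0], [b + x0]. The induction therefore has to range over all
    frequencies and phases. *)
Lemma Fourier_zero_peak (h : R -> R) (x0 a : R) :
  (forall x, continuous h x) -> (forall k, Fourier h k = 0%C) ->
  forall (n : nat) (k : Z) (b : R),
  RInt (fun x => h x * cos (IZR k * x + b) * (a + cos (x - x0)) ^ n) (- PI) PI = 0.
Proof.
  intros Hc HF. induction n as [|n IH]; intros k b.
  - rewrite <- (Fourier_zero_cos h Hc HF k b). apply RInt_ext. intros; simpl; ring.
  - set (F := fun (k : Z) b x => h x * cos (IZR k * x + b) * (a + cos (x - x0)) ^ n).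
    assert (HI : forall k b, is_RInt (F k b) (- PI) PI 0).
    { intros k' b'. rewrite <- (IH k' b').
      apply (RInt_correct (V := R_CompleteNormedModule)), ex_RInt_continuous_all.
      intros x. unfold F. apply continuous_Rmult.
      - apply continuous_Rmult; [apply Hc | apply continuous_cos_affine].
      - apply (ex_derive_continuous (V := R_NormedModule)). auto_derive; exact I. }
    apply is_RInt_unique.
    pose proof (is_RInt_lincomb _ _ _ _ (/ 2) (/ 2) _ _
      (HI (k + 1)%Z (b - x0)) (HI (k - 1)%Z (b + x0))) as H1.
    pose proof (is_RInt_lincomb _ _ _ _ a 1 _ _ (HI k b) H1) as H2.
    replace (a * 0 + 1 * (/ 2 * 0 + / 2 * 0)) with 0 in H2 by ring.
    revert H2. apply is_RInt_ext. intros x _. unfold F.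
    rewrite plus_IZR, minus_IZR.
    replace ((IZR k + 1) * x + (b - x0)) with ((IZR k * x + b) + (x - x0)) by ring.
    replace ((IZR k - 1) * x + (b + x0)) with ((IZR k * x + b) - (x - x0)) by ring.
    rewrite (cos_plus (IZR k * x + b)), (cos_minus (IZR k * x + b)). simpl. field.
Qed.

(* The kernel [(1 + cos (x - x0) - cos d) ^ n] grows geometrically near [x0]
   and is at most 1 in absolute value at distance at least [d]. *)
Lemma Fourier_zero_nonpos (h : R -> R) (x0 : R) :
  periodic h -> (forall x, continuous h x) -> (forall k, Fourier h k = 0%C) ->
  - PI < x0 < PI -> h x0 <= 0.
Proof.
  intros Hp Hc HF Hx0. apply Rnot_lt_le. intros Hpos.
  destruct (periodic_continuous_bounded h Hp Hc) as [M [HM HhM]].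
  pose proof PI_RGT_0 as HPI. pose proof PI2_3_2 as HPI2.
  (* The bounds on [d] in terms of [x0] give [|x - x0| <= 2 PI - d] on [[- PI, PI]]: points away
     from [x0] are also away from its translates by [2 PI]. The bound [d < 1] keeps [d] where the
     cosine decreases. *)
  assert (Hloc : exists d, 0 < d /\ d < 1 /\ d < x0 + PI /\ d < PI - x0 /\
     forall x, Rabs (x - x0) < d -> h x0 / 2 < h x).
  { assert (He : 0 < h x0 / 2) by lra.
    destruct (proj1 (filterlim_locally h (h x0)) (Hc x0) (mkposreal _ He)) as [d Hd].
    exists (Rmin (d / 2) (Rmin (1 / 2) (Rmin ((x0 + PI) / 2) ((PI - x0) / 2)))).
    pose proof (cond_pos d).
    repeat split.
    - repeat apply Rmin_glb_lt; lra.
    - eapply Rle_lt_trans; [apply Rmin_r|]. eapply Rle_lt_trans; [apply Rmin_l|]. lra.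
    - eapply Rle_lt_trans; [apply Rmin_r|]. eapply Rle_lt_trans; [apply Rmin_r|].
      eapply Rle_lt_trans; [apply Rmin_l|]. lra.
    - eapply Rle_lt_trans; [apply Rmin_r|]. eapply Rle_lt_trans; [apply Rmin_r|].
      eapply Rle_lt_trans; [apply Rmin_r|]. lra.
    - intros x Hx.
      assert (Rabs (x - x0) < d).
      { eapply Rlt_le_trans; [exact Hx|]. eapply Rle_trans; [apply Rmin_l|]. lra. }
      assert (Hb : Rabs (h x - h x0) < h x0 / 2) by (apply (Hd x); assumption).
      apply Rabs_lt_between in Hb. lra. }
  destruct Hloc as [d [Hd0 [Hd1 [Hd2 [Hd3 Hd]]]]].
  set (a := 1 - cos d). set (Q := fun x => a + cos (x - x0)).
  set (q := a + cos (d / 2)).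
  assert (Hq : 1 < q).
  { unfold q, a. assert (cos d < cos (d / 2)) by (apply cos_decreasing_1; lra). lra. }
  assert (HQin : forall x, Rabs (x - x0) <= d / 2 -> q <= Q x).
  { intros x Hx. unfold q, Q. apply Rplus_le_compat_l.
    replace (cos (x - x0)) with (cos (Rabs (x - x0))).
    - pose proof (Rabs_pos (x - x0)). apply cos_decr_1; lra.
    - unfold Rabs. destruct (Rcase_abs _); [apply cos_neg | reflexivity]. }
  assert (HQ1 : forall x, Rabs (x - x0) < d -> 1 <= Q x).
  { intros x Hx. unfold Q, a.
    assert (cos d <= cos (x - x0)); [|lra].
    replace (cos (x - x0)) with (cos (Rabs (x - x0))).
    - pose proof (Rabs_pos (x - x0)). apply cos_decr_1; lra.
    - unfold Rabs. destruct (Rcase_abs _); [apply cos_neg | reflexivity]. }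
  assert (HQout : forall x, - PI <= x <= PI -> d <= Rabs (x - x0) -> Rabs (Q x) <= 1).
  { intros x Hx Hxd. unfold Q, a.
    assert (Hle : cos (x - x0) <= cos d).
    { replace (cos (x - x0)) with (cos (Rabs (x - x0)))
        by (unfold Rabs; destruct (Rcase_abs _); [apply cos_neg | reflexivity]).
      assert (Rabs (x - x0) <= 2 * PI - d) by (apply Rabs_le; lra).
      destruct (Rle_dec (Rabs (x - x0)) PI).
      - apply cos_decr_1; lra.
      - replace (cos (Rabs (x - x0))) with (cos (2 * PI - Rabs (x - x0))).
        + apply cos_decr_1; lra.
        + replace (2 * PI - Rabs (x - x0)) with (- Rabs (x - x0) + 2 * INR 1 * PI) by (simpl; ring).
          rewrite cos_period. apply cos_neg. }
    assert (0 <= cos d) by (apply cos_ge_0; lra).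
    pose proof (COS_bound (x - x0)). pose proof (COS_bound d). apply Rabs_le. lra. }
  (* On the interval of length [d] around [x0] the integral is at least [d (h x0 / 2) q^n];
     elsewhere the integrand is at least [- M], so it loses at most [2 PI M]. *)
  destruct (pow_unbounded q (d * (h x0 / 2)) (2 * PI * M) Hq) as [n Hn]; [nra|].
  set (F := fun x => h x * Q x ^ n).
  assert (HFc : forall x, continuous F x).
  { intros x. unfold F. apply continuous_Rmult; [apply Hc|].
    apply (ex_derive_continuous (V := R_NormedModule)). unfold Q. auto_derive; exact I. }
  assert (HF0 : RInt F (- PI) PI = 0).
  { rewrite <- (Fourier_zero_peak h x0 a Hc HF n 0 0). apply RInt_ext.
    intros x _. unfold F, Q. simpl IZR. rewrite Rmult_0_l, Rplus_0_l, cos_0. simpl. ring. }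
  assert (HFlow : forall x, - PI <= x <= PI -> - M <= F x).
  { intros x Hx. unfold F. destruct (Rlt_dec (Rabs (x - x0)) d) as [Hlt | Hge].
    - specialize (Hd x Hlt). specialize (HQ1 x Hlt).
      assert (0 <= Q x ^ n) by (apply pow_le; lra). nra.
    - assert (Rabs (h x * Q x ^ n) <= M * 1).
      { rewrite Rabs_mult, <- RPow_abs. apply Rmult_le_compat.
        - apply Rabs_pos.
        - apply pow_le, Rabs_pos.
        - apply HhM.
        - rewrite <- (pow1 n). apply pow_incr. split; [apply Rabs_pos|].
          apply HQout; lra. }
      apply Rabs_le_between in H. lra. }
  assert (HFhigh : forall x, Rabs (x - x0) <= d / 2 -> (h x0 / 2) * q ^ n <= F x).
  { intros x Hx. unfold F. apply Rmult_le_compat.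
    - lra.
    - apply pow_le. lra.
    - apply Rlt_le, Hd. lra.
    - apply pow_incr. split; [lra|]. now apply HQin. }
  assert (Hconst : forall u v c, u <= v -> (forall x, u < x < v -> c <= F x) -> (v - u) * c <= RInt F u v).
  { intros u v c Huv Hle. replace ((v - u) * c) with (RInt (fun _ => c) u v).
    - apply RInt_le; [exact Huv | apply ex_RInt_const | apply ex_RInt_continuous_all, HFc | exact Hle].
    - rewrite RInt_const. reflexivity. }
  assert (E : RInt F (- PI) PI = RInt F (- PI) (x0 - d / 2)
     + (RInt F (x0 - d / 2) (x0 + d / 2) + RInt F (x0 + d / 2) PI)).
  { rewrite <- (RInt_Chasles F (- PI) (x0 - d / 2) PI) by (apply ex_RInt_continuous_all, HFc).
    rewrite <- (RInt_Chasles F (x0 - d / 2) (x0 + d / 2) PI) by (apply ex_RInt_continuous_all, HFc).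
    reflexivity. }
  assert (G1 : (x0 - d / 2 - - PI) * (- M) <= RInt F (- PI) (x0 - d / 2)).
  { apply Hconst; [lra|]. intros x Hx. apply HFlow. lra. }
  assert (G2 : (x0 + d / 2 - (x0 - d / 2)) * ((h x0 / 2) * q ^ n)
     <= RInt F (x0 - d / 2) (x0 + d / 2)).
  { apply Hconst; [lra|]. intros x Hx. apply HFhigh. apply Rabs_le. lra. }
  assert (G3 : (PI - (x0 + d / 2)) * (- M) <= RInt F (x0 + d / 2) PI).
  { apply Hconst; [lra|]. intros x Hx. apply HFlow. lra. }
  nra.
Qed.

(** The peak argument, for [h] and for [- h], covers the interior of the period. The remaining point
    [- PI] follows by continuity from the right. *)
Lemma Fourier_zero (h : R -> R) :
  periodic h -> (forall x, continuous h x) -> (forall k, Fourier h k = 0%C) ->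
  forall x, h x = 0.
Proof.
  intros Hp Hc HF. pose proof PI_RGT_0 as HPI.
  assert (Hco : forall x, continuous (fun y => -1 * h y) x).
  { intros x. apply (continuous_scal_r (V := R_NormedModule) (-1) h), Hc. }
  assert (Hin : forall x, - PI < x < PI -> h x = 0).
  { intros x Hx. apply Rle_antisym.
    - now apply Fourier_zero_nonpos.
    - enough (-1 * h x <= 0) by lra.
      apply (Fourier_zero_nonpos (fun y => -1 * h y)); auto.
      + intros y. now rewrite Hp.
      + intros k. rewrite Fourier_scal, HF by assumption. ring. }
  intros x. destruct (periodic_representative h x Hp) as [y [Hy ->]].
  destruct (Req_dec y (- PI)) as [-> | Hne]; [|apply Hin; lra].
  destruct (Req_dec (h (- PI)) 0) as [E | E]; [exact E|]. exfalso.
  assert (He : 0 < Rabs (h (- PI))) by now apply Rabs_pos_lt.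
  destruct (proj1 (filterlim_locally h (h (- PI))) (Hc (- PI)) (mkposreal _ He)) as [d Hd].
  pose proof (cond_pos d). set (r := Rmin (d / 2) PI).
  assert (Hr : 0 < r <= d / 2 /\ r <= PI).
  { unfold r. repeat split; [apply Rmin_glb_lt; lra | apply Rmin_l | apply Rmin_r]. }
  assert (Hb : Rabs (h (- PI + r) - h (- PI)) < Rabs (h (- PI))).
  { apply (Hd (- PI + r)). change (Rabs (- PI + r - - PI) < d).
    rewrite Rabs_pos_eq; lra. }
  rewrite Hin in Hb by lra. rewrite Rminus_0_l, Rabs_Ropp in Hb. lra.
Qed.

(** All Fourier coefficients of the difference vanish: the nonnegative ones by [Fourier_tp], the
    negative ones by conjugation. *)
Lemma band_limited_tp (K : nat) (h : R -> R) :
  periodic h -> (forall x, continuous h x) -> band_limited K h ->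
  forall x, h x = tp K (fun k => Fourier h (Z.of_nat k)) x.
Proof.
  intros Hp Hc HK x. set (c := fun k : nat => Fourier h (Z.of_nat k)).
  enough (h x + -1 * tp K c x = 0) by lra.
  assert (Hco : forall x, continuous (fun y => -1 * tp K c y) x).
  { intros y. apply (continuous_scal_r (V := R_NormedModule) (-1) (tp K c)), continuous_tp. }
  assert (Hsum : forall x, continuous (fun y => h y + -1 * tp K c y) x).
  { intros y. apply (continuous_plus (V := R_NormedModule)); auto. }
  revert x. apply Fourier_zero.
  - intros y. now rewrite Hp, periodic_tp.
  - exact Hsum.
  - assert (Hnat : forall n : nat, Fourier (fun y => h y + -1 * tp K c y) (Z.of_nat n) = 0%C).
    { intros n. rewrite Fourier_plus, Fourier_scal, Fourier_tp by first [assumption | apply continuous_tp].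
      fold (c n). destruct (Nat.eq_dec n 0) as [-> | Hn].
      - assert (Him : Im (c 0%nat) = 0) by exact (Fourier_0_real h Hc).
        replace (c 0%nat) with (RtoC (Re (c 0%nat))) at 1
          by (apply injective_projections; [reflexivity | symmetry; exact Him]).
        ring.
      - destruct (le_dec n K).
        + ring.
        + unfold c. rewrite HK by lia. ring. }
    intros k. destruct (Z_le_dec 0 k).
    + rewrite <- (Z2Nat.id k) by lia. apply Hnat.
    + rewrite <- (Z.opp_involutive k), Fourier_opp_index by exact Hsum.
      rewrite <- (Z2Nat.id (- k)) by lia. rewrite Hnat.
      unfold Cconj, RtoC; simpl; f_equal; ring.
Qed.

(** * Ordinary differential equations *)

Lemma is_derive_continuity_pt (f : R -> R) (x l : R) :
  is_derive f x l -> continuity_pt f x.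
Proof.
  intros H. apply continuity_pt_filterlim.
  apply (ex_derive_continuous (V := R_NormedModule) f). now exists l.
Qed.

Lemma nonneg_derive_incr (phi dphi : R -> R) (s t : R) :
  s <= t ->
  (forall x, s < x < t -> is_derive phi x (dphi x) /\ 0 <= dphi x) ->
  (forall x, s <= x <= t -> continuity_pt phi x) ->
  phi s <= phi t.
Proof.
  intros Hst Hd Hc.
  (* The intermediate point may be an endpoint, where nothing is known about [dphi]; truncating at 0
     keeps the sign there without changing the derivative inside. *)
  destruct (MVT_gen phi s t (fun x => Rmax 0 (dphi x))) as [c [_ E]].
  - intros x Hx. rewrite Rmin_left, Rmax_right in Hx by lra.
    destruct (Hd x Hx) as [H1 H2]. now rewrite Rmax_right.
  - intros x Hx. rewrite Rmin_left, Rmax_right in Hx by lra. now apply Hc.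
  - pose proof (Rmax_l 0 (dphi c)). nra.
Qed.

Lemma derive_bound_lipschitz (W dW : R -> R) (B : R) :
  (forall t, is_derive W t (dW t)) -> (forall t, Rabs (dW t) <= B) ->
  forall s t, Rabs (W s - W t) <= B * Rabs (s - t).
Proof.
  intros Hd HB.
  assert (Hlip : forall s t, s <= t -> Rabs (W s - W t) <= B * Rabs (s - t)).
  { intros s t Hst. destruct (MVT_gen W s t dW) as [c [_ E]].
    - intros; apply Hd.
    - intros x _. eapply is_derive_continuity_pt. apply Hd.
    - rewrite (Rabs_minus_sym s t), Rabs_minus_sym, E, Rabs_mult.
      apply Rmult_le_compat_r; [apply Rabs_pos | apply HB]. }
  intros s t. destruct (Rle_dec s t).
  - now apply Hlip.
  - rewrite Rabs_minus_sym, (Rabs_minus_sym s t). apply Hlip. lra.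
Qed.

(** The derivative of [a / b * exp (b t)] is the bound itself, so adding or subtracting [w] leaves a
    nondecreasing function. Integration costs a factor [1 / b]; the choice [b = 2 L] will turn a
    Lipschitz constant [L] into a contraction by 1/2. *)
Lemma derive_bound_exp (w w' : R -> R) (a b T : R) :
  0 < b -> 0 <= a -> w 0 = 0 ->
  (forall t, 0 < t < T -> is_derive w t (w' t) /\ Rabs (w' t) <= a * exp (b * t)) ->
  (forall t, 0 <= t <= T -> continuity_pt w t) ->
  forall t, 0 <= t <= T -> Rabs (w t) <= a / b * exp (b * t).
Proof.
  intros Hb Ha H0 Hd Hc t Ht.
  assert (Hab : 0 <= a / b) by (apply Rdiv_le_0_compat; lra).
  assert (Hexp : forall x, is_derive (fun y => a / b * exp (b * y)) x (a * exp (b * x))).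
  { intros x. auto_derive; [exact I|]. field. lra. }
  assert (Hexpc : forall x, continuity_pt (fun y => a / b * exp (b * y)) x).
  { intros x. eapply is_derive_continuity_pt. apply Hexp. }
  apply Rabs_le. split.
  - enough (a / b * exp (b * 0) + w 0 <= a / b * exp (b * t) + w t).
    { rewrite Rmult_0_r, exp_0 in H. lra. }
    apply (nonneg_derive_incr (fun x => a / b * exp (b * x) + w x)
      (fun x => a * exp (b * x) + w' x)); [lra| |].
    + intros x Hx. destruct (Hd x) as [H1 H2]; [lra|]. split.
      * apply (is_derive_plus (V := R_NormedModule)); auto.
      * apply Rabs_le_between in H2. lra.
    + intros x Hx. apply (continuity_pt_plus (fun y => a / b * exp (b * y)) w); auto. apply Hc; lra.
  - enough (a / b * exp (b * 0) - w 0 <= a / b * exp (b * t) - w t).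
    { rewrite Rmult_0_r, exp_0 in H. lra. }
    apply (nonneg_derive_incr (fun x => a / b * exp (b * x) - w x)
      (fun x => a * exp (b * x) - w' x)); [lra| |].
    + intros x Hx. destruct (Hd x) as [H1 H2]; [lra|]. split.
      * apply (is_derive_minus (V := R_NormedModule)); auto.
      * apply Rabs_le_between in H2. lra.
    + intros x Hx. apply (continuity_pt_minus (fun y => a / b * exp (b * y)) w); auto. apply Hc; lra.
Qed.

Lemma geometric_squeeze (x c : R) :
  (forall n : nat, Rabs x <= c / 2 ^ n) -> x = 0.
Proof.
  intros H. destruct (Req_dec x 0) as [E | E]; [exact E|]. exfalso.
  destruct (pow_unbounded 2 (Rabs x) c) as [n Hn]; [lra | now apply Rabs_pos_lt |].
  specialize (H n). assert (H2 : 0 < 2 ^ n) by (apply pow_lt; lra).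
  apply (Rmult_le_compat_r (2 ^ n)) in H; [|lra].
  unfold Rdiv in H. rewrite Rmult_assoc, Rinv_l in H; lra.
Qed.

(* Iterating [derive_bound_exp] gains a factor 1/2 at each step. *)
Lemma linear_inequality_zero (J : Type) (w w' : R -> J -> R) (L T A : R) :
  0 < L -> (forall i, w 0 i = 0) ->
  (forall i t, 0 <= t <= T -> continuity_pt (fun s => w s i) t) ->
  (forall i t, 0 < t < T -> is_derive (fun s => w s i) t (w' t i)) ->
  (forall i t, 0 <= t <= T -> Rabs (w t i) <= A) ->
  (forall t M, 0 < t < T -> (forall j, Rabs (w t j) <= M) ->
     forall i, Rabs (w' t i) <= L * M) ->
  forall i t, 0 <= t <= T -> w t i = 0.
Proof.
  intros HL H0 Hc Hd HA Hw i t Ht.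
  apply (geometric_squeeze _ (A * exp (2 * L * t))). intros n.
  revert i t Ht. induction n as [|n IH]; intros i t Ht.
  - simpl. assert (1 <= exp (2 * L * t)).
    { rewrite <- exp_0. destruct (Req_dec t 0) as [-> | Hne].
      - rewrite Rmult_0_r. lra.
      - left. apply exp_increasing. nra. }
    specialize (HA i t Ht). pose proof (Rabs_pos (w t i)). unfold Rdiv. rewrite Rinv_1. nra.
  - assert (HA0 : 0 <= A).
    { eapply Rle_trans; [apply Rabs_pos | apply (HA i t Ht)]. }
    assert (Hp : 0 < 2 ^ n) by (apply pow_lt; lra).
    assert (Hq : 0 <= A / 2 ^ n) by (apply Rdiv_le_0_compat; lra).
    replace (A * exp (2 * L * t) / 2 ^ S n) with ((L * (A / 2 ^ n)) / (2 * L) * exp (2 * L * t)).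
    + apply (derive_bound_exp (fun s => w s i) (fun s => w' s i) _ _ T); auto; [lra | nra |].
      intros s Hs. split; [apply Hd; exact Hs|].
      replace (L * (A / 2 ^ n) * exp (2 * L * s)) with (L * (A * exp (2 * L * s) / 2 ^ n)) by (field; lra).
      apply Hw; [exact Hs|]. intros j. apply IH. lra.
    + simpl. field. lra.
Qed.

(** A Lipschitz constant in time common to all coordinates makes the integrand continuous, whatever
    the size of [J]. The bound [B] on [G] returns the same constant, so this class of functions is
    stable under the iteration. *)
Lemma picard_step (J : Type) (G : (J -> R) -> J -> R) (L B : R) (v : R -> J -> R) (i : J) :
  0 < L ->
  (forall v i, Rabs (G v i) <= B) ->
  (forall v w M, (forall j, Rabs (v j - w j) <= M) ->
     forall i, Rabs (G v i - G w i) <= L * M) ->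
  (forall s t j, Rabs (v s j - v t j) <= B * Rabs (s - t)) ->
  forall a : R,
  let W := fun t => a + RInt (fun s => G (v (Rabs s)) i) 0 t in
  (forall t, is_derive W t (G (v (Rabs t)) i)) /\
  (forall s t, Rabs (W s - W t) <= B * Rabs (s - t)).
Proof.
  intros HL HB HG Hv a W.
  assert (HB0 : 0 <= B) by (eapply Rle_trans; [apply Rabs_pos | apply (HB (v 0) i)]).
  assert (Hcont : forall t, continuous (fun s => G (v (Rabs s)) i) t).
  { intros t. apply continuity_pt_filterlim. intros e He.
    (* [B + 1] instead of [B], which may be 0. *)
    exists (e / (L * (B + 1))). split.
    - apply Rdiv_lt_0_compat; [exact He | nra].
    - intros s [_ Hs]. unfold dist in *; simpl in *. unfold Rdist in *.
      assert (H1 : Rabs (G (v (Rabs s)) i - G (v (Rabs t)) i) <= L * (B * Rabs (s - t))).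
      { apply HG. intros j. eapply Rle_trans; [apply Hv|].
        apply Rmult_le_compat_l; [exact HB0|]. apply Rabs_triang_inv2. }
      assert (H2 : L * (B + 1) * Rabs (s - t) < e).
      { apply (Rmult_lt_compat_l (L * (B + 1))) in Hs; [|nra].
        replace (L * (B + 1) * (e / (L * (B + 1)))) with e in Hs by (field; split; lra). exact Hs. }
      pose proof (Rabs_pos (s - t)). nra. }
  assert (Hd : forall t, is_derive W t (G (v (Rabs t)) i)).
  { intros t. unfold W.
    evar_last.
    - apply (is_derive_plus (V := R_NormedModule)); [apply (is_derive_const (V := R_NormedModule))|].
      apply (is_derive_RInt (V := R_NormedModule) (fun s => G (v (Rabs s)) i) _ 0 t).
      + apply filter_forall. intros s.
        apply (RInt_correct (V := R_CompleteNormedModule)).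
        apply ex_RInt_continuous_all. exact Hcont.
      + apply Hcont.
    - unfold plus, zero; simpl. ring. }
  split; [exact Hd|].
  intros s t. apply (derive_bound_lipschitz W (fun t => G (v (Rabs t)) i)).
  - exact Hd.
  - intros; apply HB.
Qed.

(** In the norm weighted by [exp (- 2 L t)] the integral operator contracts by 1/2 on all of
    [[0, oo)] at once, so no continuation in time is needed. Norms appear as bounds on all
    coordinates. The field is read at [Rabs t], which gives a solution on the whole line with a
    two-sided derivative at 0. *)
Lemma picard (J : Type) (G : (J -> R) -> J -> R) (L B : R) (u0 : J -> R) :
  0 < L ->
  (forall v i, Rabs (G v i) <= B) ->
  (forall v w M, (forall j, Rabs (v j - w j) <= M) ->
     forall i, Rabs (G v i - G w i) <= L * M) ->
  exists u : R -> J -> R,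
    (forall i, u 0 i = u0 i) /\
    (forall i t, is_derive (fun s => u s i) t (G (u (Rabs t)) i)).
Proof.
  intros HL HB HG.
  set (Phi := fun (v : R -> J -> R) t i => u0 i + RInt (fun s => G (v (Rabs s)) i) 0 t).
  set (lip := fun v : R -> J -> R => forall s t j, Rabs (v s j - v t j) <= B * Rabs (s - t)).
  assert (HPhi0 : forall v i, Phi v 0 i = u0 i).
  { intros v i. unfold Phi. rewrite RInt_point. unfold zero; simpl. ring. }
  assert (HPhid : forall v, lip v -> forall i t, is_derive (fun s => Phi v s i) t (G (v (Rabs t)) i)).
  { intros v Hv i. apply (picard_step J G L B v i HL HB HG Hv (u0 i)). }
  assert (HPhil : forall v, lip v -> lip (Phi v)).
  { intros v Hv s t i. apply (picard_step J G L B v i HL HB HG Hv (u0 i)). }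
  assert (HPhic : forall v, lip v -> forall i t, continuity_pt (fun s => Phi v s i) t).
  { intros v Hv i t. eapply is_derive_continuity_pt. now apply HPhid. }
  assert (Hcontr : forall v w A, lip v -> lip w -> 0 <= A ->
    (forall i t, 0 <= t -> Rabs (v t i - w t i) <= A * exp (2 * L * t)) ->
    forall i t, 0 <= t -> Rabs (Phi v t i - Phi w t i) <= A / 2 * exp (2 * L * t)).
  { intros v w A Hv Hw HA Hvw i t Ht.
    replace (A / 2) with (L * A / (2 * L)) by (field; lra).
    apply (derive_bound_exp (fun s => Phi v s i - Phi w s i)
      (fun s => G (v (Rabs s)) i - G (w (Rabs s)) i) _ _ t); [lra | nra | | | | lra].
    - rewrite !HPhi0. ring.
    - intros s Hs. split.
      + apply (is_derive_minus (V := R_NormedModule)); now apply HPhid.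
      + rewrite Rmult_assoc. apply HG. intros j. rewrite (Rabs_pos_eq s) by lra.
        apply Hvw. lra.
    - intros s _. apply (continuity_pt_minus (fun s => Phi v s i) (fun s => Phi w s i)); now apply HPhic. }
  (* For an empty [J] the hypotheses do not force [0 <= B], and there is nothing to solve. *)
  destruct (classic (inhabited J)) as [[j0] | HJ].
  2: { exists (fun _ => u0). split; [reflexivity|]. intros i. destruct HJ. now constructor. }
  assert (HB0 : 0 <= B) by (eapply Rle_trans; [apply Rabs_pos | apply (HB u0 j0)]).
  set (U := fun n => Nat.iter n Phi (fun _ => u0)).
  assert (HUlip : forall n, lip (U n)).
  { induction n as [|n IH].
    - intros s t j. simpl. rewrite Rminus_diag, Rabs_R0. pose proof (Rabs_pos (s - t)). nra.
    - apply HPhil. exact IH. }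
  (* The first iterate moves by at most [B t = A (2 L t) <= A exp (2 L t)]. *)
  set (A := B / (2 * L)).
  assert (HA : 0 <= A) by (apply Rdiv_le_0_compat; lra).
  assert (Hstep : forall n i t, 0 <= t -> Rabs (U (S n) t i - U n t i) <= A / 2 ^ n * exp (2 * L * t)).
  { induction n as [|n IH].
    - intros i t Ht. pose proof (HUlip 1%nat t 0 i) as H.
      replace (U 1%nat 0 i) with (u0 i) in H by (symmetry; apply (HPhi0 (U 0%nat))).
      eapply Rle_trans; [exact H|]. rewrite Rminus_0_r, Rabs_pos_eq by exact Ht.
      simpl. pose proof (exp_ineq1_le (2 * L * t)).
      replace (B * t) with (A * (2 * L * t)) by (unfold A; field; lra).
      replace (A / 1) with A by field. apply Rmult_le_compat_l; lra.
    - intros i t Ht. assert (Hp : 0 < 2 ^ n) by (apply pow_lt; lra).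
      replace (A / 2 ^ S n) with (A / 2 ^ n / 2) by (simpl; field; lra).
      apply (Hcontr (U (S n)) (U n)); auto. apply Rdiv_le_0_compat; lra. }
  assert (Htail : forall n k i t, 0 <= t ->
    Rabs (U (k + n)%nat t i - U n t i) <= 2 * A * exp (2 * L * t) / 2 ^ n).
  { intros n k i t Ht. pose proof (exp_pos (2 * L * t)).
    assert (Hp : 0 < 2 ^ n) by (apply pow_lt; lra).
    (* The exact value of the geometric sum, which the induction on [k] carries along. *)
    enough (Rabs (U (k + n)%nat t i - U n t i) <= 2 * A * exp (2 * L * t) * (/ 2 ^ n - / 2 ^ (k + n))).
    { assert (0 < / 2 ^ (k + n)) by (apply Rinv_0_lt_compat, pow_lt; lra). unfold Rdiv.
      assert (0 <= 2 * A * exp (2 * L * t)) by nra. nra. }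
    induction k as [|k IH].
    - simpl. rewrite Rminus_diag, Rabs_R0, Rminus_diag. lra.
    - replace (U (S k + n)%nat t i - U n t i) with
        ((U (S (k + n)) t i - U (k + n)%nat t i) + (U (k + n)%nat t i - U n t i)) by (simpl; ring).
      eapply Rle_trans; [apply Rabs_triang|].
      specialize (Hstep (k + n)%nat i t Ht).
      assert (Hq : 0 < 2 ^ (k + n)) by (apply pow_lt; lra).
      replace (2 * A * exp (2 * L * t) * (/ 2 ^ n - / 2 ^ (S k + n))) with
        (A / 2 ^ (k + n) * exp (2 * L * t) + 2 * A * exp (2 * L * t) * (/ 2 ^ n - / 2 ^ (k + n)))
        by (simpl; field; lra).
      lra. }
  set (u := fun t i => real (Lim_seq (fun n => U n (Rabs t) i))).
  assert (Hlim : forall t i, is_lim_seq (fun n => U n (Rabs t) i) (u t i)).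
  { intros t i. apply Lim_seq_correct'. apply ex_lim_seq_cauchy_corr.
    intros e. set (c := 2 * A * exp (2 * L * Rabs t)).
    assert (Hc0 : 0 <= c) by (unfold c; pose proof (exp_pos (2 * L * Rabs t)); nra).
    destruct (pow_unbounded 2 e (2 * c)) as [N HN]; [lra | apply cond_pos |].
    assert (Hp : 0 < 2 ^ N) by (apply pow_lt; lra).
    assert (HcN : c / 2 ^ N < e / 2).
    { apply (Rmult_lt_reg_r (2 ^ N)); [exact Hp|]. unfold Rdiv at 1.
      rewrite Rmult_assoc, Rinv_l; lra. }
    exists N. intros n m Hn Hm.
    pose proof (Htail N (n - N)%nat i (Rabs t) (Rabs_pos t)) as H1.
    pose proof (Htail N (m - N)%nat i (Rabs t) (Rabs_pos t)) as H2.
    replace (n - N + N)%nat with n in H1 by lia. replace (m - N + N)%nat with m in H2 by lia.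
    fold c in H1, H2.
    replace (U n (Rabs t) i - U m (Rabs t) i) with
      ((U n (Rabs t) i - U N (Rabs t) i) - (U m (Rabs t) i - U N (Rabs t) i)) by ring.
    eapply Rle_lt_trans; [apply Rabs_triang|]. rewrite Rabs_Ropp. lra. }
  assert (Hulip : lip u).
  { intros s t j.
    assert (H : Rbar_le (Rabs (u s j - u t j)) (B * Rabs (s - t))); [|exact H].
    apply (is_lim_seq_le (fun n => Rabs (U n (Rabs s) j - U n (Rabs t) j)) (fun _ => B * Rabs (s - t))).
    - intros n. eapply Rle_trans; [apply HUlip|].
      apply Rmult_le_compat_l; [exact HB0|]. apply Rabs_triang_inv2.
    - apply (is_lim_seq_abs _ (Finite (u s j - u t j))).
      apply is_lim_seq_minus'; apply Hlim.
    - apply is_lim_seq_const. }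
  assert (Hclose : forall n i t, 0 <= t -> Rabs (u t i - U n t i) <= 2 * A * exp (2 * L * t) / 2 ^ n).
  { intros n i t Ht.
    assert (H : Rbar_le (Rabs (u t i - U n t i)) (2 * A * exp (2 * L * t) / 2 ^ n)); [|exact H].
    apply (is_lim_seq_le (fun k => Rabs (U (k + n)%nat t i - U n t i)) (fun _ => 2 * A * exp (2 * L * t) / 2 ^ n)).
    - intros k. now apply Htail.
    - apply (is_lim_seq_abs _ (Finite (u t i - U n t i))).
      apply is_lim_seq_minus'; [|apply is_lim_seq_const].
      pose proof (Hlim t i) as Hl. rewrite Rabs_pos_eq in Hl by exact Ht.
      apply (is_lim_seq_incr_n _ n) in Hl. exact Hl.
    - apply is_lim_seq_const. }
  assert (Hfix : forall i t, 0 <= t -> Phi u t i = u t i).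
  { intros i t Ht. apply Rminus_diag_uniq.
    apply (geometric_squeeze _ (2 * A * exp (2 * L * t))). intros n.
    assert (Hp : 0 < 2 ^ n) by (apply pow_lt; lra).
    replace (Phi u t i - u t i) with ((Phi u t i - U (S n) t i) - (u t i - U (S n) t i)) by ring.
    eapply Rle_trans; [apply Rabs_triang|]. rewrite Rabs_Ropp.
    pose proof (Hclose (S n) i t Ht) as H1.
    assert (H2 : Rabs (Phi u t i - Phi (U n) t i) <= 2 * A / 2 ^ n / 2 * exp (2 * L * t)).
    { apply Hcontr; auto.
      - apply Rdiv_le_0_compat; lra.
      - intros j s Hs. replace (2 * A / 2 ^ n * exp (2 * L * s)) with (2 * A * exp (2 * L * s) / 2 ^ n) by (field; lra).
        now apply Hclose. }
    change (Phi (U n)) with (U (S n)) in H2.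
    replace (2 * A * exp (2 * L * t) / 2 ^ n) with
      (2 * A / 2 ^ n / 2 * exp (2 * L * t) + 2 * A * exp (2 * L * t) / 2 ^ S n) by (simpl; field; lra).
    lra. }
  (* The limit [u] is even in time and satisfies the integral equation only for [t >= 0]; [Phi u]
     agrees with it there and is differentiable everywhere. *)
  exists (Phi u). split; [intros; apply HPhi0|].
  intros i t. evar_last; [now apply HPhid|].
  apply Rminus_diag_uniq.
  (* [u] and [Phi u] agree at [Rabs t] only coordinatewise; the Lipschitz hypothesis with bound 0
     replaces functional extensionality. *)
  assert (H : Rabs (G (u (Rabs t)) i - G (Phi u (Rabs t)) i) <= L * 0).
  { apply HG. intros j. rewrite Hfix by apply Rabs_pos. rewrite Rminus_diag, Rabs_R0. lra. }
  rewrite Rmult_0_r in H. pose proof (Rabs_pos (G (u (Rabs t)) i - G (Phi u (Rabs t)) i)).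
  destruct (Req_dec (G (u (Rabs t)) i - G (Phi u (Rabs t)) i) 0) as [E | E]; [exact E|].
  apply Rabs_pos_lt in E. lra.
Qed.

(** * Positivity and global existence *)

Lemma Cmod_le_components (z : C) : Cmod z <= Rabs (Re z) + Rabs (Im z).
Proof.
  replace z with (Re z + Ci * Im z)%C at 1.
  - eapply Rle_trans; [apply Cmod_triangle|].
    rewrite Cmod_mult, Cmod_Ci, !Cmod_R. lra.
  - destruct z as [a b]. unfold Ci, RtoC, Cmult, Cplus; simpl. f_equal; ring.
Qed.

Lemma im_le_Cmod (z : C) : Rabs (Im z) <= Cmod z.
Proof. eapply Rle_trans; [apply Rmax_r | apply Rmax_Cmod]. Qed.

Lemma Cmod_mult_sub (a b a' b' : C) (D e : R) :
  Cmod b <= D -> Cmod a' <= D -> Cmod (a - a') <= e -> Cmod (b - b') <= e ->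
  Cmod (a * b - a' * b') <= 2 * D * e.
Proof.
  intros Hb Ha' Ha Hbb.
  replace (a * b - a' * b')%C with ((a - a') * b + a' * (b - b'))%C by ring.
  eapply Rle_trans; [apply Cmod_triangle|]. rewrite !Cmod_mult.
  assert (Cmod (a - a') * Cmod b <= e * D) by (apply Rmult_le_compat; auto using Cmod_ge_0).
  assert (Cmod a' * Cmod (b - b') <= D * e) by (apply Rmult_le_compat; auto using Cmod_ge_0).
  lra.
Qed.

(** Each product of two coefficients moves by at most [2 D e]. The linear weight is [n <= K]; the
    sum has [K] terms of weight [2 (n + 2 j) <= 6 K]. *)
Lemma coef_rhs_lipschitz (K n : nat) (c d : nat -> C) (D e : R) :
  (n <= K)%nat ->
  (forall k, Cmod (c k) <= D) -> (forall k, Cmod (d k) <= D) ->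
  (forall k, Cmod (c k - d k) <= e) ->
  Cmod (coef_rhs K c n - coef_rhs K d n) <= (INR K + 6 * INR K ^ 2) * (2 * D) * e.
Proof.
  intros Hn Hc Hd He.
  assert (HD : 0 <= D) by (eapply Rle_trans; [apply Cmod_ge_0 | apply (Hc 0%nat)]).
  assert (He0 : 0 <= e) by (eapply Rle_trans; [apply Cmod_ge_0 | apply (He 0%nat)]).
  assert (HnK : INR n <= INR K) by (apply le_INR; exact Hn).
  pose proof (pos_INR n). pose proof (pos_INR K).
  replace (coef_rhs K c n - coef_rhs K d n)%C with
   (- (RtoC (INR n) * (c 0%nat * c n - d 0%nat * d n)) +
    csum (fun j => RtoC (2 * (INR n + 2 * INR j)) *
      - (c (n + j)%nat * Cconj (c j) - d (n + j)%nat * Cconj (d j))) K)%C.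
  - eapply Rle_trans; [apply Cmod_triangle|].
    rewrite Cmod_opp, Cmod_mult, Cmod_R, Rabs_pos_eq by assumption.
    assert (H1 : INR n * Cmod (c 0%nat * c n - d 0%nat * d n) <= INR K * (2 * D * e)).
    { apply Rmult_le_compat; auto using Cmod_ge_0. now apply Cmod_mult_sub. }
    assert (H2 : Cmod (csum (fun j => RtoC (2 * (INR n + 2 * INR j)) *
      - (c (n + j)%nat * Cconj (c j) - d (n + j)%nat * Cconj (d j)))%C K)
      <= INR K * (6 * INR K * (2 * D * e))).
    { apply Cmod_csum_le. intros j Hj.
      assert (INR j <= INR K) by (apply le_INR; lia). pose proof (pos_INR j).
      rewrite Cmod_mult, Cmod_R, Cmod_opp, Rabs_pos_eq by lra.
      apply Rmult_le_compat; auto using Cmod_ge_0; [lra | lra |].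
      apply Cmod_mult_sub; auto.
      - now rewrite Cmod_conj.
      - rewrite <- Cminus_conj, Cmod_conj. auto. }
    simpl pow. lra.
  - unfold coef_rhs.
    rewrite (csum_ext _ (fun j => (- (1)) * (RtoC (2 * (INR n + 2 * INR j)) * c (n + j)%nat * Cconj (c j))
      + RtoC (2 * (INR n + 2 * INR j)) * d (n + j)%nat * Cconj (d j))%C) by (intros; ring).
    rewrite csum_plus, csum_mult_l. ring.
Qed.

Lemma coef_rhs_zero (K n : nat) : coef_rhs K (fun _ => RtoC 0) n = 0%C.
Proof.
  unfold coef_rhs. rewrite csum_zero; [ring|]. intros k _. ring.
Qed.

Lemma csum_nonneg (a : nat -> C) (n : nat) :
  (forall k, 0 <= Re (a k) /\ Im (a k) = 0) ->
  0 <= Re (csum a n) /\ Im (csum a n) = 0.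
Proof.
  intros H. induction n as [|n [IH1 IH2]].
  - rewrite csum_0. simpl. lra.
  - rewrite csum_S, re_plus, im_plus. specialize (H (S n)). lra.
Qed.

(** For [n = 0] the right-hand side is minus the sum of [4 j |c_j|^2], for any [c]. It thus keeps
    the mean real and nonincreasing also when the coefficients in it are clamped. *)
Lemma coef_rhs_0_nonpos (K : nat) (c : nat -> C) :
  Re (coef_rhs K c 0) <= 0 /\ Im (coef_rhs K c 0) = 0.
Proof.
  destruct (csum_nonneg (fun j => RtoC (2 * (INR 0 + 2 * INR j)) * c (0 + j)%nat * Cconj (c j))%C K) as [H1 H2].
  - intros j. change (0 + j)%nat with j.
    rewrite <- Cmult_assoc, <- Cmod2_conj, re_scal_l, im_scal_l.
    rewrite re_RtoC, im_RtoC. simpl INR. pose proof (pos_INR j).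
    pose proof (Cmod_ge_0 (c j)). split; [|ring].
    apply Rmult_le_pos; [lra | apply pow_le; assumption].
  - unfold coef_rhs. unfold Cminus. simpl (INR 0) at 1 3.
    rewrite Cmult_0_l, Cmult_0_l, Copp_0, Cplus_0_l, re_opp, im_opp. lra.
Qed.

Lemma tp_bound (K : nat) (d : nat -> C) (D x : R) :
  (forall k, (k <= K)%nat -> Cmod (d k) <= D) -> Rabs (tp K d x) <= (1 + 2 * INR K) * D.
Proof.
  intros H. unfold tp. eapply Rle_trans; [apply Rabs_triang|].
  rewrite Rabs_mult, (Rabs_pos_eq 2) by lra.
  assert (Rabs (Re (d 0%nat)) <= D) by (eapply Rle_trans; [apply re_le_Cmod | apply H; lia]).
  assert (Rabs (Re (csum (fun k => d k * expi (INR k * x))%C K)) <= INR K * D).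
  { eapply Rle_trans; [apply re_le_Cmod|]. apply Cmod_csum_le. intros k Hk.
    rewrite Cmod_mult, Cmod_expi, Rmult_1_r. apply H. lia. }
  lra.
Qed.

Lemma wave_components (a : C) (k : nat) (x : R) :
  wave (2 * a) k x = 2 * (Re a * cos (INR k * x) - Im a * sin (INR k * x)).
Proof. unfold wave. rewrite <- Cmult_assoc, Re_2_mult, re_mult. reflexivity. Qed.

Lemma is_derive_tp_coef (K : nat) (c : R -> nat -> C) (dc : nat -> C) (x t : R) :
  (forall k, (k <= K)%nat -> is_derive (fun s => Re (c s k)) t (Re (dc k)) /\
                             is_derive (fun s => Im (c s k)) t (Im (dc k))) ->
  is_derive (fun s => tp K (c s) x) t (tp K dc x).
Proof.
  intros H. induction K as [|K IH].
  - rewrite tp_0. apply (is_derive_ext (fun s => Re (c s 0%nat))).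
    + intros; now rewrite tp_0.
    + apply H. lia.
  - rewrite tp_S. apply (is_derive_ext (fun s => tp K (c s) x + wave (2 * c s (S K)) (S K) x)).
    + intros; now rewrite tp_S.
    + apply (is_derive_plus (V := R_NormedModule)).
      * apply IH. intros; apply H; lia.
      * rewrite wave_components.
        apply (is_derive_ext (fun s => 2 * (Re (c s (S K)) * cos (INR (S K) * x) - Im (c s (S K)) * sin (INR (S K) * x)))).
        { intros s. now rewrite wave_components. }
        destruct (H (S K)) as [H1 H2]; [lia|].
        apply is_derive_scal. apply (is_derive_minus (V := R_NormedModule)).
        -- exact (is_derive_scal_l (V := R_NormedModule) _ t _ (cos (INR (S K) * x)) H1).
        -- exact (is_derive_scal_l (V := R_NormedModule) _ t _ (sin (INR (S K) * x)) H2).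
Qed.

Lemma continuous_tp_spacetime (K : nat) (c : R -> nat -> C) (p : R * R) :
  (forall k t, (k <= K)%nat -> continuous (fun s => Re (c s k)) t /\ continuous (fun s => Im (c s k)) t) ->
  continuous (fun q : R * R => tp K (c (snd q)) (fst q)) p.
Proof.
  intros H.
  assert (Hsnd : forall f : R -> R, (forall t, continuous f t) -> continuous (fun q : R * R => f (snd q)) p).
  { intros f Hf. apply (continuous_comp (snd : R * R -> R) f); [apply continuous_snd | apply Hf]. }
  assert (Hfst : forall f : R -> R, (forall t, continuous f t) -> continuous (fun q : R * R => f (fst q)) p).
  { intros f Hf. apply (continuous_comp (fst : R * R -> R) f); [apply continuous_fst | apply Hf]. }
  induction K as [|K IH].
  - apply (continuous_ext (fun q : R * R => Re (c (snd q) 0%nat))).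
    + intros; now rewrite tp_0.
    + apply (Hsnd (fun s => Re (c s 0%nat))). intros; apply H; lia.
  - apply (continuous_ext (fun q : R * R => plus (tp K (c (snd q)) (fst q))
      (scal 2 (minus (mult (Re (c (snd q) (S K))) (cos (INR (S K) * fst q)))
                     (mult (Im (c (snd q) (S K))) (sin (INR (S K) * fst q))))))).
    + intros q. rewrite tp_S, wave_components. reflexivity.
    + apply (continuous_plus (V := R_NormedModule)); [apply IH; intros; apply H; lia|].
      apply (continuous_scal_r (V := R_NormedModule)).
      apply (continuous_minus (V := R_NormedModule)); apply (continuous_mult (K := R_AbsRing)).
      * apply (Hsnd (fun s => Re (c s (S K)))). intros; apply H; lia.
      * apply (Hfst (fun y => cos (INR (S K) * y))). intros; apply continuous_cos_lin.
      * apply (Hsnd (fun s => Im (c s (S K)))). intros; apply H; lia.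
      * apply (Hfst (fun y => sin (INR (S K) * y))). intros; apply continuous_sin_lin.
Qed.

(** The a priori estimate: positivity turns control of the mean into control of every coefficient.
    The components are bounded separately because the clamping acts on them separately. *)
Lemma Fourier_nonneg_bound (h : R -> R) (k : Z) :
  (forall x, continuous h x) -> (forall x, 0 <= h x) ->
  Rabs (Re (Fourier h k)) <= Re (Fourier h 0) /\ Rabs (Im (Fourier h k)) <= Re (Fourier h 0).
Proof.
  intros Hc Hh. pose proof PI_RGT_0.
  assert (HP : 0 < / (2 * PI)) by (apply Rinv_0_lt_compat; lra).
  rewrite !Fourier_components, !re_scal_l, im_scal_l by exact Hc. simpl Re; simpl Im.
  rewrite !Rabs_mult, Rabs_Ropp, (Rabs_pos_eq (/ (2 * PI))) by lra.
  replace (RInt (fun x => h x * cos (0 * x)) (- PI) PI) with (RInt h (- PI) PI).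
  2: { apply RInt_ext. intros x _. rewrite Rmult_0_l, cos_0. simpl. ring. }
  assert (Hb : forall g : R -> R, (forall x, continuous g x) -> (forall x, -1 <= g x <= 1) ->
    Rabs (RInt (fun x => h x * g x) (- PI) PI) <= RInt h (- PI) PI).
  { intros g Hg Hg1.
    assert (He : ex_RInt h (- PI) PI) by now apply ex_RInt_continuous_all.
    assert (He' : ex_RInt (fun x => h x * g x) (- PI) PI).
    { apply ex_RInt_continuous_all. intros; apply continuous_Rmult; auto. }
    apply Rabs_le. split.
    - rewrite <- (RInt_opp (V := R_CompleteNormedModule)) by exact He.
      apply RInt_le; [lra | now apply (ex_RInt_opp (V := R_NormedModule)) | exact He' |].
      intros x _. specialize (Hh x). specialize (Hg1 x). unfold opp; simpl. nra.
    - apply RInt_le; [lra | exact He' | exact He |].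
      intros x _. specialize (Hh x). specialize (Hg1 x). nra. }
  split; (apply Rmult_le_compat_l; [lra|]; apply Hb).
  - intros; apply continuous_cos_lin.
  - intros; apply COS_bound.
  - intros; apply continuous_sin_lin.
  - intros; apply SIN_bound.
Qed.

(** Only difference quotients from the left are used, since at a first contact the comparison is
    known for earlier times alone. *)
Lemma derive_nonpos_of_left_min (g : R -> R) (t l : R) :
  0 < t -> (forall s, 0 <= s < t -> g t <= g s) -> is_derive g t l -> l <= 0.
Proof.
  intros Ht Hg Hd. apply Rnot_lt_le. intros Hl.
  apply is_derive_Reals in Hd. destruct (Hd l Hl) as [d Hdd].
  pose proof (cond_pos d). set (r := Rmin (d / 2) (t / 2)).
  assert (Hr : 0 < r /\ r <= d / 2 /\ r <= t / 2).
  { unfold r. repeat split; [apply Rmin_glb_lt; lra | apply Rmin_l | apply Rmin_r]. }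
  assert (Hlt : Rabs ((g (t + - r) - g t) / - r - l) < l).
  { apply Hdd; [lra|]. rewrite Rabs_Ropp, Rabs_pos_eq; lra. }
  assert (Hgr : g t <= g (t + - r)) by (apply Hg; lra).
  assert (Hq : (g (t + - r) - g t) / - r <= 0).
  { replace ((g (t + - r) - g t) / - r) with (- ((g (t + - r) - g t) * / r)) by (field; lra).
    assert (0 < / r) by (apply Rinv_0_lt_compat; lra). nra. }
  apply Rabs_lt_between in Hlt. lra.
Qed.

Lemma derive_zero_at_min (f : R -> R) (x l : R) :
  (forall y, f x <= f y) -> is_derive f x l -> l = 0.
Proof.
  intros Hmin Hd. apply is_derive_Reals in Hd.
  set (pr := exist _ l Hd : derivable_pt f x).
  change l with (derive_pt f x pr). apply (deriv_minimum f (x - 1) (x + 1)); auto; lra.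
Qed.

(** Induction along an interval: the supremum of the times up to which [P] holds satisfies [P] by
    closedness, and lies at the end by openness to the right. *)
Lemma real_induction (P : R -> Prop) (T : R) :
  P 0 ->
  (forall t, 0 <= t < T -> P t -> exists d, 0 < d /\ forall s, t <= s < t + d -> P s) ->
  (forall t, 0 < t <= T -> (forall s, 0 <= s < t -> P s) -> P t) ->
  forall t, 0 <= t <= T -> P t.
Proof.
  intros H0 Hopen Hclosed t Ht.
  set (E := fun s => 0 <= s <= t /\ forall r, 0 <= r <= s -> P r).
  destruct (completeness E) as [b [Hub Hlub]].
  - exists t. intros s [Hs _]. lra.
  - exists 0. split; [lra|]. intros r Hr. now replace r with 0 by lra.
  - assert (Hb0 : 0 <= b).
    { apply Hub. split; [lra|]. intros r Hr. now replace r with 0 by lra. }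
    assert (Hbt : b <= t) by (apply Hlub; intros s [Hs _]; lra).
    assert (Hbelow : forall s, 0 <= s < b -> P s).
    { intros s Hs. apply NNPP. intros HP.
      assert (b <= s); [|lra]. apply Hlub. intros r [Hr HE].
      apply Rnot_lt_le. intros Hsr. apply HP, HE. lra. }
    assert (HPb : P b).
    { destruct (Req_dec b 0) as [-> | Hne]; [exact H0|]. apply Hclosed; [lra | exact Hbelow]. }
    destruct (Req_dec b t) as [<- | Hne]; [exact HPb|]. exfalso.
    destruct (Hopen b) as [d [Hd HdP]]; [lra | exact HPb |].
    set (r := Rmin (d / 2) (t - b)).
    assert (Hr : 0 < r /\ r <= d / 2 /\ r <= t - b).
    { unfold r. repeat split; [apply Rmin_glb_lt; lra | apply Rmin_l | apply Rmin_r]. }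
    assert (b + r <= b); [|lra]. apply Hub. split; [lra|].
    intros s Hs. destruct (Rlt_dec s b); [apply Hbelow; lra | apply HdP; lra].
Qed.

Definition clamp (M r : R) : R := Rmax (- M) (Rmin M r).

Lemma clamp_bound (M r : R) : 0 <= M -> Rabs (clamp M r) <= M.
Proof.
  intros HM. unfold clamp, Rmax, Rmin.
  repeat destruct (Rle_dec _ _); apply Rabs_le; lra.
Qed.

Lemma clamp_id (M r : R) : Rabs r <= M -> clamp M r = r.
Proof.
  intros H. apply Rabs_le_between in H. unfold clamp. rewrite Rmin_right, Rmax_right; lra.
Qed.

Lemma clamp_lipschitz (M r s : R) : 0 <= M -> Rabs (clamp M r - clamp M s) <= Rabs (r - s).
Proof.
  intros HM. unfold clamp, Rmax, Rmin.
  repeat destruct (Rle_dec _ _); unfold Rabs; repeat destruct (Rcase_abs _); lra.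
Qed.

(** [picard] works with real coordinates: [(true, k)] carries the real part and [(false, k)] the
    imaginary part of the coefficient [k]. *)
Definition clamped_coefs (K : nat) (M : R) (v : bool * nat -> R) (k : nat) : C :=
  if le_dec k K then (clamp M (v (true, k)), clamp M (v (false, k))) else RtoC 0.

Definition clamped_field (K : nat) (M : R) (v : bool * nat -> R) (i : bool * nat) : R :=
  if le_dec (snd i) K
  then (if fst i then Re else Im) (coef_rhs K (clamped_coefs K M v) (snd i))
  else 0.

Lemma clamped_coefs_bound (K : nat) (M : R) (v : bool * nat -> R) (k : nat) :
  0 <= M -> Cmod (clamped_coefs K M v k) <= 2 * M.
Proof.
  intros HM. unfold clamped_coefs. destruct (le_dec k K).
  - eapply Rle_trans; [apply Cmod_le_components|]. simpl.
    pose proof (clamp_bound M (v (true, k)) HM). pose proof (clamp_bound M (v (false, k)) HM). lra.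
  - rewrite Cmod_0. lra.
Qed.

Lemma component_le_Cmod (b : bool) (z : C) : Rabs ((if b then Re else Im) z) <= Cmod z.
Proof. destruct b; [apply re_le_Cmod | apply im_le_Cmod]. Qed.

Lemma clamped_field_lipschitz (K : nat) (M : R) (v w : bool * nat -> R) (e : R) :
  0 <= M -> (forall j, Rabs (v j - w j) <= e) ->
  forall i, Rabs (clamped_field K M v i - clamped_field K M w i)
    <= (INR K + 6 * INR K ^ 2) * (2 * (2 * M)) * (2 * e).
Proof.
  intros HM He [b n]. unfold clamped_field. cbn [fst snd].
  assert (He0 : 0 <= e) by (eapply Rle_trans; [apply Rabs_pos | apply (He (true, n))]).
  pose proof (pos_INR K).
  destruct (le_dec n K) as [Hn | Hn].
  - replace ((if b then Re else Im) (coef_rhs K (clamped_coefs K M v) n) -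
      (if b then Re else Im) (coef_rhs K (clamped_coefs K M w) n)) with
     ((if b then Re else Im) (coef_rhs K (clamped_coefs K M v) n - coef_rhs K (clamped_coefs K M w) n)%C)
      by (unfold Cminus; destruct b; [rewrite re_plus, re_opp | rewrite im_plus, im_opp]; ring).
    eapply Rle_trans; [apply component_le_Cmod|].
    apply coef_rhs_lipschitz; auto using clamped_coefs_bound.
    intros k. unfold clamped_coefs. destruct (le_dec k K).
    + eapply Rle_trans; [apply Cmod_le_components|]. simpl.
      pose proof (clamp_lipschitz M (v (true, k)) (w (true, k)) HM).
      pose proof (clamp_lipschitz M (v (false, k)) (w (false, k)) HM).
      pose proof (He (true, k)). pose proof (He (false, k)). unfold Rminus in *. lra.
    + replace (0 - 0)%C with (RtoC 0) by ring. rewrite Cmod_0. lra.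
  - rewrite Rminus_diag, Rabs_R0. apply Rmult_le_pos; [|lra].
    apply Rmult_le_pos; [|lra]. nra.
Qed.

Lemma coef_rhs_bound (K n : nat) (c : nat -> C) (D : R) :
  (n <= K)%nat -> (forall k, Cmod (c k) <= D) ->
  Cmod (coef_rhs K c n) <= (INR K + 6 * INR K ^ 2) * (2 * D) * D.
Proof.
  intros Hn Hc.
  assert (HD : 0 <= D) by (eapply Rle_trans; [apply Cmod_ge_0 | apply (Hc 0%nat)]).
  replace (coef_rhs K c n) with (coef_rhs K c n - coef_rhs K (fun _ => RtoC 0) n)%C
    by (rewrite coef_rhs_zero; ring).
  apply coef_rhs_lipschitz; auto.
  - intros _. now rewrite Cmod_0.
  - intros k. replace (c k - 0)%C with (c k) by ring. apply Hc.
Qed.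

Lemma coef_rhs_ext (K n : nat) (c d : nat -> C) :
  (forall k, c k = d k) -> coef_rhs K c n = coef_rhs K d n.
Proof.
  intros H. unfold coef_rhs. rewrite !H. f_equal.
  apply csum_ext. intros j _. now rewrite !H.
Qed.

(* The solution is built for the clamped, globally Lipschitz system.  The mean
   [c 0] is nonincreasing for it, and it dominates the other coefficients as
   long as the trigonometric polynomial is nonnegative, so the clamping at
   [c 0 + 1] is inactive up to the first zero; and there is no first zero by
   the minimum principle. *)
Lemma coef_global_solution (K : nat) (c0 : nat -> C) :
  (forall k, (K < k)%nat -> c0 k = 0%C) -> Im (c0 0%nat) = 0 ->
  (forall x, 0 < tp K c0 x) ->
  exists c : R -> nat -> C,
    (forall k, c 0 k = c0 k) /\
    (forall t k, (K < k)%nat -> c t k = 0%C) /\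
    (forall t, Im (c t 0%nat) = 0) /\
    (forall k t, continuous (fun s => Re (c s k)) t /\ continuous (fun s => Im (c s k)) t) /\
    (forall k t, 0 <= t -> (k <= K)%nat ->
       is_derive (fun s => Re (c s k)) t (Re (coef_rhs K (c t) k)) /\
       is_derive (fun s => Im (c s k)) t (Im (coef_rhs K (c t) k))) /\
    (forall x t, 0 <= t -> 0 < tp K (c t) x).
Proof.
  intros HK Him Hpos.
  set (M := Rabs (Re (c0 0%nat)) + 1).
  assert (HM : 0 <= M) by (unfold M; pose proof (Rabs_pos (Re (c0 0%nat))); lra).
  pose proof (pos_INR K) as HINR.
  set (W := (INR K + 6 * INR K ^ 2) * (2 * (2 * M))).
  assert (HW : 0 <= W) by (unfold W; apply Rmult_le_pos; nra).
  (* [W] is the Lipschitz constant of [coef_rhs] for moduli up to [2 M]. A bound [e] on both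
     components allows [2 e] for the modulus, hence [2 * W]; the added 1 makes the constant positive
     when [K = 0]. *)
  destruct (picard (bool * nat) (clamped_field K M) (2 * W + 1) (W * (2 * M))
    (fun i => (if fst i then Re else Im) (c0 (snd i)))) as [u [Hu0 Hud]].
  { lra. }
  { intros v [b n]. unfold clamped_field; cbn [fst snd]. destruct (le_dec n K) as [Hn|Hn].
    - eapply Rle_trans; [apply component_le_Cmod|].
      apply coef_rhs_bound; auto using clamped_coefs_bound.
    - rewrite Rabs_R0. nra. }
  { intros v w e He i. eapply Rle_trans; [apply (clamped_field_lipschitz K M v w e HM He)|].
    fold W. assert (0 <= e) by (eapply Rle_trans; [apply Rabs_pos | apply (He i)]). nra. }
  set (g := fun t => clamped_coefs K M (u (Rabs t))).
  set (c := fun t k => if le_dec k K then (u t (true, k), u t (false, k)) else RtoC 0).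
  assert (Hd : forall k t, (k <= K)%nat ->
     is_derive (fun s => Re (c s k)) t (Re (coef_rhs K (g t) k)) /\
     is_derive (fun s => Im (c s k)) t (Im (coef_rhs K (g t) k))).
  { intros k t Hk. pose proof (Hud (true, k) t) as H1. pose proof (Hud (false, k) t) as H2.
    unfold clamped_field in H1, H2; cbn [fst snd] in H1, H2.
    destruct (le_dec k K) as [Hk'|]; [|lia]. split.
    - eapply is_derive_ext; [|exact H1]. intros s. unfold c. destruct (le_dec k K); [reflexivity | lia].
    - eapply is_derive_ext; [|exact H2]. intros s. unfold c. destruct (le_dec k K); [reflexivity | lia]. }
  assert (Hc0 : forall k, c 0 k = c0 k).
  { intros k. unfold c. destruct (le_dec k K).
    - rewrite !Hu0. simpl. now destruct (c0 k).
    - symmetry. apply HK. lia. }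
  assert (Hmean : forall t, 0 <= t -> Re (c t 0%nat) <= Re (c0 0%nat)).
  { intros t Ht. rewrite <- Hc0. enough (- Re (c 0 0%nat) <= - Re (c t 0%nat)) by lra.
    assert (Hdm : forall x, is_derive (fun s => - Re (c s 0%nat)) x (- Re (coef_rhs K (g x) 0))).
    { intros x. apply (is_derive_opp (V := R_NormedModule) (fun s => Re (c s 0%nat))). apply Hd. lia. }
    apply (nonneg_derive_incr (fun s => - Re (c s 0%nat)) (fun s => - Re (coef_rhs K (g s) 0))); [exact Ht | |].
    - intros x _. split; [apply Hdm|]. destruct (coef_rhs_0_nonpos K (g x)). lra.
    - intros x _. eapply is_derive_continuity_pt. apply Hdm. }
  assert (Him0 : forall t, Im (c t 0%nat) = 0).
  { intros t. pose proof (derive_bound_lipschitz (fun s => Im (c s 0%nat)) (fun s => Im (coef_rhs K (g s) 0)) 0) as H.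
    specialize (H (fun t => proj2 (Hd 0%nat t (Nat.le_0_l K)))).
    assert (H0 : forall s, Rabs (Im (coef_rhs K (g s) 0)) <= 0).
    { intros s. destruct (coef_rhs_0_nonpos K (g s)) as [_ ->]. rewrite Rabs_R0. lra. }
    specialize (H H0 t 0). cbv beta in H. rewrite Hc0, Him, Rminus_0_r in H.
    rewrite Rmult_0_l in H. apply Rabs_le_between in H. lra. }
  assert (Hinactive : forall t, 0 <= t -> (forall x, 0 <= tp K (c t) x) -> forall k, g t k = c t k).
  { intros t Ht Hnn k. unfold g. rewrite Rabs_pos_eq by exact Ht.
    unfold clamped_coefs, c. destruct (le_dec k K) as [Hk|]; [|reflexivity].
    assert (Hb : Rabs (Re (c t k)) <= Re (c t 0%nat) /\ Rabs (Im (c t k)) <= Re (c t 0%nat)).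
    { pose proof (Fourier_nonneg_bound (tp K (c t)) (Z.of_nat k) (continuous_tp K (c t)) Hnn) as H.
      pose proof (Fourier_tp K (c t) 0) as E0. simpl Z.of_nat in E0.
      destruct (Nat.eq_dec 0 0) in E0; [|lia]. rewrite E0, re_RtoC, Fourier_tp in H.
      destruct (Nat.eq_dec k 0) as [-> | ].
      - rewrite Him0, Rabs_R0. rewrite re_RtoC in H. pose proof (Rabs_pos (Re (c t 0%nat))). lra.
      - destruct (le_dec k K); [exact H | lia]. }
    specialize (Hmean t Ht). pose proof (Rle_abs (Re (c0 0%nat))).
    assert (Ec : c t k = (u t (true, k), u t (false, k))) by (unfold c; destruct (le_dec k K); [reflexivity | lia]).
    destruct Hb as [Hb1 Hb2].
    replace (Re (c t k)) with (u t (true, k)) in Hb1 by now rewrite Ec.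
    replace (Im (c t k)) with (u t (false, k)) in Hb2 by now rewrite Ec.
    rewrite !clamp_id; [reflexivity | unfold M; lra | unfold M; lra]. }
  assert (Hft : forall x t, is_derive (fun s => tp K (c s) x) t (tp K (coef_rhs K (g t)) x)).
  { intros x t. apply is_derive_tp_coef. intros k Hk. now apply Hd. }
  set (Lam := (1 + 2 * INR K) * (W * (2 * M))).
  assert (HLam : 0 <= Lam) by (unfold Lam; apply Rmult_le_pos; nra).
  assert (Hlip : forall x s t, Rabs (tp K (c s) x - tp K (c t) x) <= Lam * Rabs (s - t)).
  { intros x. apply (derive_bound_lipschitz (fun s => tp K (c s) x) (fun t => tp K (coef_rhs K (g t)) x)); [apply Hft|].
    intros t. apply tp_bound. intros k Hk. apply coef_rhs_bound; [exact Hk|].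
    intros j. now apply clamped_coefs_bound. }
  assert (Hpositive : forall x t, 0 <= t -> 0 < tp K (c t) x).
  { destruct (periodic_continuous_min (tp K c0) (periodic_tp K c0) (continuous_tp K c0)) as [x0 Hx0].
    set (m := tp K c0 x0) in *. assert (Hm : 0 < m) by apply Hpos.
    intros x T HT.
    (* The barrier [m - e (1 + t)] starts below the minimum [m] and decreases to [m / 2] at time
       [T]. Its slope makes the comparison strict: the minimum principle alone only gives a
       nonnegative time derivative at a contact. *)
    set (e := m / (2 * (1 + T))).
    assert (He : 0 < e) by (apply Rdiv_lt_0_compat; lra).
    assert (HeT : e * (1 + T) = m / 2) by (unfold e; field; lra).
    assert (Hbar : forall t, 0 <= t <= T -> 0 < m - e * (1 + t)) by (intros t Ht; nra).
    assert (HP : forall t, 0 <= t <= T -> forall y, m - e * (1 + t) < tp K (c t) y).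
    { apply (real_induction (fun t => forall y, m - e * (1 + t) < tp K (c t) y)).
      - intros y. rewrite (tp_ext K (c 0) c0) by (intros; apply Hc0). specialize (Hx0 y). lra.
      - intros t Ht HPt.
        destruct (periodic_continuous_min (tp K (c t)) (periodic_tp K (c t)) (continuous_tp K (c t))) as [x1 Hx1].
        set (eta := tp K (c t) x1 - (m - e * (1 + t))).
        assert (Heta : 0 < eta) by (unfold eta; specialize (HPt x1); lra).
        (* One time step serves all [y], because the Lipschitz constant [Lam] in time is uniform in
           space. *)
        exists (eta / (Lam + 1)). split; [apply Rdiv_lt_0_compat; lra|].
        intros s Hs y. specialize (Hx1 y). specialize (Hlip y s t).
        rewrite (Rabs_pos_eq (s - t)) in Hlip by lra.
        assert (Hst : (Lam + 1) * (s - t) < eta).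
        { assert (Hs' : s - t < eta / (Lam + 1)) by lra.
          apply (Rmult_lt_compat_l (Lam + 1)) in Hs'; [|lra].
          replace ((Lam + 1) * (eta / (Lam + 1))) with eta in Hs' by (field; lra). exact Hs'. }
        apply Rabs_le_between in Hlip. unfold eta in Hst. nra.
      - intros t Ht HPt y. apply Rnot_le_lt. intros Hle.
        (* By continuity in time the inequality at earlier times survives weakly at [t]. The point
           [y] where strictness fails is then a global minimum point lying on the barrier. *)
        assert (Hge : forall z, m - e * (1 + t) <= tp K (c t) z).
        { intros z. apply Rnot_lt_le. intros Hlt.
          set (eta := (m - e * (1 + t)) - tp K (c t) z).
          set (r := Rmin t (eta / (2 * (Lam + 1)))).
          assert (Heta : 0 < eta) by (unfold eta; lra).
          assert (Heta2 : 0 < eta / (2 * (Lam + 1))) by (apply Rdiv_lt_0_compat; lra).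
          assert (Hr : 0 < r /\ r <= t /\ r <= eta / (2 * (Lam + 1))).
          { unfold r. repeat split; [apply Rmin_glb_lt; lra | apply Rmin_l | apply Rmin_r]. }
          assert (Hr' : (Lam + 1) * r <= eta / 2).
          { destruct Hr as [_ [_ Hr]]. apply (Rmult_le_compat_l (Lam + 1)) in Hr; [|lra].
            replace ((Lam + 1) * (eta / (2 * (Lam + 1)))) with (eta / 2) in Hr by (field; lra). exact Hr. }
          specialize (HPt (t - r)). specialize (Hlip z (t - r) t).
          replace (t - r - t) with (- r) in Hlip by ring.
          rewrite (Rabs_Ropp r), (Rabs_pos_eq r) in Hlip by lra.
          apply Rabs_le_between in Hlip.
          assert (m - e * (1 + (t - r)) < tp K (c (t - r)) z) by (apply HPt; lra).
          unfold eta in Hr'. nra. }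
        assert (Heq : tp K (c t) y = m - e * (1 + t)) by (apply Rle_antisym; auto).
        assert (Hmin : forall z, tp K (c t) y <= tp K (c t) z) by (intros z; rewrite Heq; apply Hge).
        assert (Hbt : 0 < m - e * (1 + t)) by (apply Hbar; lra).
        assert (Hg : forall k, g t k = c t k).
        { apply Hinactive; [lra|]. intros z. specialize (Hge z). lra. }
        assert (Hrhs : 0 <= tp K (coef_rhs K (c t)) y).
        { rewrite <- tp_coef_rhs; [| apply Him0 |].
          - rewrite (derive_zero_at_min _ _ _ Hmin (is_derive_tp K (c t) y)).
            pose proof (half_Laplacian_nonpos_at_min _ _ _ Hmin (is_half_Laplacian_tp K (c t) y)).
            nra.
          - intros k Hk. unfold c. destruct (le_dec k K); [lia | reflexivity]. }
        (* The gap to the barrier is positive before [t] and zero at [t], so its derivative there,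
           which is the left-hand side, is nonpositive. *)
        enough (tp K (coef_rhs K (c t)) y + e <= 0) by lra.
        apply (derive_nonpos_of_left_min (fun s => tp K (c s) y - (m - e * (1 + s))) t); [lra | |].
        + intros s Hs. rewrite Heq. assert (m - e * (1 + s) < tp K (c s) y) by (apply HPt; lra). lra.
        + assert (Hdb : is_derive (fun s => m - e * (1 + s)) t (- e)) by (auto_derive; [exact I | ring]).
          evar_last; [exact (is_derive_minus _ _ _ _ _ (Hft y t) Hdb)|].
          unfold minus, plus, opp; simpl.
          replace (tp K (coef_rhs K (g t)) y) with (tp K (coef_rhs K (c t)) y); [ring|].
          apply tp_ext. intros k _. now apply coef_rhs_ext. }
    eapply Rlt_trans; [apply (Hbar T); lra | apply HP; lra]. }
  assert (Houtside : forall t k, (K < k)%nat -> c t k = RtoC 0).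
  { intros t k Hk. unfold c. destruct (le_dec k K); [lia | reflexivity]. }
  exists c. refine (conj Hc0 (conj Houtside (conj Him0 (conj _ (conj _ Hpositive))))).
  - intros k t. destruct (le_dec k K) as [Hk | Hk].
    + destruct (Hd k t Hk) as [H1 H2]. split; apply continuity_pt_filterlim.
      * exact (is_derive_continuity_pt _ _ _ H1).
      * exact (is_derive_continuity_pt _ _ _ H2).
    + split; apply (continuous_ext (fun _ => 0)); try apply continuous_const;
        intros s; rewrite Houtside by lia; reflexivity.
  - intros k t Ht Hk.
    replace (coef_rhs K (c t) k) with (coef_rhs K (g t) k); [now apply Hd|].
    apply coef_rhs_ext, Hinactive; [exact Ht | intros; now apply Rlt_le, Hpositive].
Qed.

(** * From solutions to the coefficient system *)

Lemma expi_mult_INR (a : R) (j : nat) : expi (INR (S j) * a) = (expi (INR j * a) * expi a)%C.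
Proof. rewrite <- expi_plus. f_equal. rewrite S_INR. ring. Qed.

Lemma csum_geometric (a : R) (n : nat) :
  (csum (fun j => expi (INR j * a)) n * (expi a - 1) = expi (INR (S n) * a) - expi a)%C.
Proof.
  induction n as [|n IH].
  - rewrite csum_0. simpl INR. rewrite Rmult_1_l. ring.
  - rewrite csum_S, Cmult_plus_distr_r, IH, (expi_mult_INR a (S n)). ring.
Qed.

(** For [l <> 0], [expi a] is an [N]-th root of unity other than 1, as [N] does not divide [l]; the
    geometric sum times [expi a - 1] is 0. *)
Lemma roots_of_unity_sum (N : nat) (l : Z) :
  (Z.abs l < Z.of_nat N)%Z ->
  csum (fun j => expi (IZR l * (2 * PI / INR N * INR j))) N
  = if Z.eq_dec l 0 then RtoC (INR N) else RtoC 0.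
Proof.
  intros Hl. assert (HN : 0 < INR N) by (apply lt_0_INR; lia).
  destruct (Z.eq_dec l 0) as [-> | Hl0].
  - rewrite (csum_ext _ (fun _ => RtoC 1)).
    + clear. induction N as [|n IH]; [apply csum_0|].
      rewrite csum_S, IH, S_INR, RtoC_plus. reflexivity.
    + intros j _. rewrite Rmult_0_l. apply expi_0.
  - set (a := IZR l * (2 * PI / INR N)).
    rewrite (csum_ext _ (fun j => expi (INR j * a)))
      by (intros j _; f_equal; unfold a; ring).
    assert (HNa : expi (INR N * a) = 1%C).
    { replace (INR N * a) with (2 * IZR l * PI) by (unfold a; field; lra).
      destruct (Z_le_dec 0 l).
      - rewrite <- (Z2Nat.id l), <- INR_IZR_INZ by lia. apply expi_2PI.
      - replace (2 * IZR l * PI) with (- (2 * IZR (- l) * PI)) by (rewrite opp_IZR; ring).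
        rewrite <- (Z2Nat.id (- l)), <- INR_IZR_INZ by lia.
        rewrite expi_opp, expi_2PI. unfold Cconj, RtoC; simpl; f_equal; ring. }
    assert (Hne : (expi a - 1)%C <> RtoC 0).
    { intros E. apply (f_equal Re) in E. unfold expi in E. simpl in E.
      replace a with (2 * (a / 2)) in E by field. rewrite cos_2a_sin in E.
      assert (Hs : sin (a / 2) = 0).
      { apply Rsqr_0_uniq. unfold Rsqr. lra. }
      apply sin_eq_0_0 in Hs. destruct Hs as [k Hk].
      pose proof PI_RGT_0.
      assert (Hlk : IZR l = IZR k * INR N).
      { apply (Rmult_eq_reg_r (PI / INR N)).
        - replace (IZR l * (PI / INR N)) with (a / 2) by (unfold a; field; lra).
          rewrite Hk. field. lra.
        - apply Rgt_not_eq, Rdiv_lt_0_compat; lra. }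
      rewrite INR_IZR_INZ, <- mult_IZR in Hlk. apply eq_IZR in Hlk.
      assert (k <> 0%Z) by (intros ->; lia).
      rewrite Hlk, Z.abs_mul, (Z.abs_eq (Z.of_nat N)) in Hl by lia. nia. }
    pose proof (csum_geometric a N) as E.
    rewrite expi_mult_INR, HNa in E. replace (1 * expi a - expi a)%C with (RtoC 0) in E by ring.
    apply NNPP. intros Hz. apply (Cmult_neq_0 _ _ Hz Hne E).
Qed.

(** The condition [m + k < N] excludes aliasing: [m - k] and [- m - k] are both smaller than [N] in
    absolute value. *)
Lemma dft_wave (N m k : nat) (a : C) :
  (m + k < N)%nat ->
  csum (fun j => RtoC (wave a m (2 * PI / INR N * INR j))
                 * expi (- INR k * (2 * PI / INR N * INR j)))%C N
  = (RtoC (INR N) *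
    ((if Z.eq_dec (Z.of_nat m - Z.of_nat k) 0 then a / 2 else 0)
    + (if Z.eq_dec (- Z.of_nat m - Z.of_nat k) 0 then Cconj a / 2 else 0)))%C.
Proof.
  intros Hmk.
  rewrite (csum_ext _ (fun j =>
    a / 2 * expi (IZR (Z.of_nat m - Z.of_nat k) * (2 * PI / INR N * INR j))
    + Cconj a / 2 * expi (IZR (- Z.of_nat m - Z.of_nat k) * (2 * PI / INR N * INR j)))%C).
  - rewrite csum_plus, !csum_mult_l, !roots_of_unity_sum by lia.
    repeat match goal with |- context [Z.eq_dec ?u ?v] => destruct (Z.eq_dec u v) end; ring.
  - intros j _. set (x := 2 * PI / INR N * INR j). unfold wave.
    rewrite re_alt, Cmult_conj, <- expi_opp.
    rewrite !minus_IZR, opp_IZR, <- !INR_IZR_INZ.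
    replace ((INR m - INR k) * x) with (INR m * x + (- INR k * x)) by ring.
    replace ((- INR m - INR k) * x) with (- (INR m * x) + (- INR k * x)) by ring.
    rewrite !expi_plus. unfold Cdiv. ring.
Qed.

(* The values at the [N > K + k] points [2 PI j / N] determine the coefficient [c k]. *)
Lemma dft_tp (N K k : nat) (c : nat -> C) :
  (K + k < N)%nat ->
  csum (fun j => RtoC (tp K c (2 * PI / INR N * INR j))
                 * expi (- INR k * (2 * PI / INR N * INR j)))%C N
  = (RtoC (INR N) *
    (if Nat.eq_dec k 0 then RtoC (Re (c 0%nat)) else if le_dec k K then c k else 0))%C.
Proof.
  induction K as [|K IH]; intros HN.
  - rewrite (csum_ext _ (fun j => RtoC (wave (RtoC (Re (c 0%nat))) 0 (2 * PI / INR N * INR j))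
       * expi (- INR k * (2 * PI / INR N * INR j)))%C).
    + rewrite dft_wave by lia. f_equal. destruct (Nat.eq_dec k 0) as [-> | Hn].
      * simpl. replace (Cconj (Re (c 0%nat))) with (RtoC (Re (c 0%nat)))
          by (unfold Cconj, RtoC; simpl; f_equal; ring). field.
      * repeat match goal with |- context [Z.eq_dec ?u ?v] => destruct (Z.eq_dec u v); [lia|] end.
        destruct (le_dec k 0); [lia|]. ring.
    + intros j _. rewrite tp_0. unfold wave. simpl (INR 0).
      rewrite Rmult_0_l, expi_0, Cmult_1_r. reflexivity.
  - rewrite (csum_ext _ (fun j =>
       RtoC (tp K c (2 * PI / INR N * INR j)) * expi (- INR k * (2 * PI / INR N * INR j))
       + RtoC (wave (2 * c (S K)) (S K) (2 * PI / INR N * INR j))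
         * expi (- INR k * (2 * PI / INR N * INR j)))%C)
      by (intros j _; rewrite tp_S, RtoC_plus; ring).
    rewrite csum_plus, IH, dft_wave by lia.
    rewrite <- Cmult_plus_distr_l. f_equal.
    destruct (Z.eq_dec (- Z.of_nat (S K) - Z.of_nat k) 0); [lia|].
    destruct (Nat.eq_dec k 0) as [-> | Hn].
    + destruct (Z.eq_dec (Z.of_nat (S K) - Z.of_nat 0) 0); [lia|]. ring.
    + destruct (Z.eq_dec (Z.of_nat (S K) - Z.of_nat k) 0).
      * replace k with (S K) by lia.
        destruct (le_dec (S K) K); [lia|]. destruct (le_dec (S K) (S K)); [|lia]. field.
      * destruct (le_dec k K); destruct (le_dec k (S K)); try lia; ring.
Qed.

Lemma time_nonneg (t : R) : 0 <= t -> time p_infty t.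
Proof. intros Ht. split; [exact Ht | exact I]. Qed.

(** [filterdiff] speaks of every limit point of its filter; for the neighbourhoods restricted to
    nonnegative times, [t] is the only one. *)
Lemma within_time_lim (t x : R) :
  0 <= t -> is_filter_lim (within (time p_infty) (locally t)) x -> x = t.
Proof.
  intros Ht H. apply NNPP. intros Hne.
  assert (He : 0 < Rabs (t - x)) by (apply Rabs_pos_lt; lra).
  assert (Hx : locally x (fun y => Rabs (y - x) < Rabs (t - x))).
  { exists (mkposreal _ He). intros y Hy. exact Hy. }
  specialize (H _ Hx). apply locally_singleton in H.
  specialize (H (time_nonneg t Ht)). lra.
Qed.

Lemma is_time_derive_ext {V : NormedModule R_AbsRing} (f g : R -> V) (t : R) (l : V) :
  0 <= t -> (forall s, 0 <= s -> f s = g s) ->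
  is_time_derive p_infty f t l -> is_time_derive p_infty g t l.
Proof.
  intros Ht E. unfold is_time_derive. apply filterdiff_ext_loc.
  - unfold within. apply filter_forall. intros s [Hs _]. now apply E.
  - intros x Hx. apply (within_time_lim t x Ht) in Hx. subst. now apply E.
Qed.

Lemma is_derive_is_time_derive {V : NormedModule R_AbsRing} (T : Rbar) (f : R -> V) (t : R) (l : V) :
  is_derive f t l -> is_time_derive T f t l.
Proof.
  intros [Hl Hd]. split; [exact Hl|]. intros x Hx.
  destruct (Req_dec x t) as [-> | Hne].
  - apply (is_domin_le (F := locally t)); [apply Hd; intros P HP; exact HP | apply filter_le_within].
  (* A limit point other than [t] occurs only if the restricted filter is trivial, as when [t] is
     away from [[0, T)]: it then contains two disjoint balls and every estimate holds in it. *)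
  - assert (He : 0 < Rabs (t - x) / 2) by (apply Rdiv_lt_0_compat; [apply Rabs_pos_lt|]; lra).
    intros eps.
    assert (Hxn : locally x (fun y => Rabs (y - x) < Rabs (t - x) / 2)).
    { exists (mkposreal _ He). intros y Hy. exact Hy. }
    assert (Htn : locally t (fun y => Rabs (y - t) < Rabs (t - x) / 2)).
    { exists (mkposreal _ He). intros y Hy. exact Hy. }
    apply Hx in Hxn. unfold within in *.
    generalize (filter_and _ _ Hxn Htn). apply filter_imp. intros y [H1 H2] HT. exfalso.
    specialize (H1 HT). pose proof (Rabs_triang (t - y) (y - x)) as H3.
    replace (t - y + (y - x)) with (t - x) in H3 by ring.
    rewrite (Rabs_minus_sym t y) in H3. lra.
Qed.

Lemma is_time_derive_is_derive {V : NormedModule R_AbsRing} (f : R -> V) (t : R) (l : V) :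
  0 < t -> is_time_derive p_infty f t l -> is_derive f t l.
Proof.
  intros Ht [Hl Hd]. split; [exact Hl|]. intros x Hx.
  apply (is_filter_lim_locally_unique (V := R_NormedModule)) in Hx. subst x.
  apply (is_domin_le (F := within (time p_infty) (locally t))).
  - apply Hd. intros P HP. apply filter_le_within. exact HP.
  - intros P HP. unfold within in HP.
    assert (Hp : locally t (fun s => 0 <= s)).
    { exists (mkposreal t Ht). intros s Hs. change (Rabs (s - t) < t) in Hs.
      apply Rabs_lt_between in Hs. lra. }
    generalize (filter_and _ _ HP Hp). apply filter_imp. intros s [H1 H2].
    apply H1. now apply time_nonneg.
Qed.

(** Reflection at 0 turns continuity from the right into the two-sided continuity that extremum and
    mean value theorems require. *)
Lemma is_time_derive_continuity_abs (f : R -> R) (t l : R) :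
  0 <= t -> is_time_derive p_infty f t l -> continuity_pt (fun s => f (Rabs s)) t.
Proof.
  intros Ht Hd. apply continuity_pt_filterlim. rewrite (Rabs_pos_eq t Ht).
  apply (filterlim_comp _ _ _ Rabs f _ (within (time p_infty) (locally t))).
  - intros P HP. unfold within in HP. unfold filtermap.
    assert (Hc : filterlim Rabs (locally t) (locally t)).
    { rewrite <- (Rabs_pos_eq t Ht) at 2. apply continuity_pt_filterlim, Rcontinuity_abs. }
    specialize (Hc _ HP). unfold filtermap in Hc. revert Hc. apply filter_imp.
    intros s H. apply H, time_nonneg, Rabs_pos.
  - apply (filterdiff_continuous_aux (U := R_NormedModule) (V := R_NormedModule) f); [exists (fun s => scal s l); exact Hd|].
    intros P HP. apply filter_le_within. exact HP.
Qed.

Lemma is_time_derive_components (T : Rbar) (f : R -> C) (t : R) (l : C) :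
  is_time_derive (V := C_R_NormedModule) T f t l ->
  is_time_derive T (fun s => Re (f s)) t (Re l) /\
  is_time_derive T (fun s => Im (f s)) t (Im l).
Proof.
  intros H. split.
  - exact (filterdiff_comp (U := R_NormedModule) (V := C_R_NormedModule) (W := R_NormedModule)
      f (fun z : C => fst z) _ _ H (filterdiff_linear _ is_linear_fst)).
  - exact (filterdiff_comp (U := R_NormedModule) (V := C_R_NormedModule) (W := R_NormedModule)
      f (fun z : C => snd z) _ _ H (filterdiff_linear _ is_linear_snd)).
Qed.

Lemma is_time_derive_csum (T : Rbar) (h : nat -> R -> R) (l : nat -> R) (w : nat -> C) (t : R) (n : nat) :
  (forall j, is_time_derive T (h j) t (l j)) ->
  is_time_derive (V := C_R_NormedModule) T (fun s => csum (fun j => RtoC (h j s) * w j)%C n) t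
    (csum (fun j => RtoC (l j) * w j)%C n).
Proof.
  intros H. induction n as [|n IH].
  - apply (filterdiff_ext (V := C_R_NormedModule) (fun _ => zero)).
    { intros s. now rewrite csum_0. }
    eapply filterdiff_ext_lin; [apply filterdiff_const|].
    intros y. rewrite csum_0. symmetry. apply (scal_zero_r (V := C_R_NormedModule)).
  - apply (filterdiff_ext (V := C_R_NormedModule)
      (fun s => plus (csum (fun j => RtoC (h j s) * w j)%C n) (scal (h (S n) s) (w (S n))))).
    { intros s. rewrite csum_S, scal_R_Cmult. reflexivity. }
    eapply filterdiff_ext_lin.
    + apply (filterdiff_plus_fct (V := C_R_NormedModule)); [exact IH|].
      apply (filterdiff_scal_l_fct (V := C_R_NormedModule)). apply (H (S n)).
    + intros y. rewrite csum_S. rewrite !scal_R_Cmult.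
      change (y * csum (fun j => RtoC (l j) * w j) n + RtoC (y * l (S n)) * w (S n)
        = y * (csum (fun j => RtoC (l j) * w j) n + RtoC (l (S n)) * w (S n)))%C.
      rewrite RtoC_mult. ring.
Qed.

Definition coef_ode (K : nat) (c : R -> nat -> C) : Prop :=
  (forall t k, 0 <= t -> (K < k)%nat -> c t k = RtoC 0) /\
  (forall t k, 0 <= t -> (k <= K)%nat ->
     is_time_derive (V := C_R_NormedModule) p_infty (fun s => c s k) t (coef_rhs K (c t) k)).

Lemma coef_ode_component (K : nat) (c : R -> nat -> C) (b : bool) (k : nat) (t : R) :
  coef_ode K c -> 0 <= t -> (k <= K)%nat ->
  is_time_derive p_infty (fun s => (if b then Re else Im) (c s k)) t
    ((if b then Re else Im) (coef_rhs K (c t) k)).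
Proof.
  intros [_ Hd] Ht Hk.
  pose proof (is_time_derive_components _ _ _ _ (Hd t k Ht Hk)) as [H1 H2].
  destruct b; assumption.
Qed.

(** On a bounded range of coefficients the quadratic right-hand side is Lipschitz; compactness of
    the time interval supplies that range for the uniqueness proof. *)
Lemma coef_ode_bounded (K : nat) (c : R -> nat -> C) (T : R) :
  coef_ode K c -> 0 <= T ->
  exists D, forall t k, 0 <= t <= T -> Cmod (c t k) <= D.
Proof.
  intros Hode HT.
  assert (H : forall n : nat, (n <= S K)%nat -> exists D, 0 <= D /\ forall t k, 0 <= t <= T -> (k < n)%nat -> Cmod (c t k) <= D).
  { induction n as [|n IH]; intros Hn.
    - exists 0. split; [lra|]. intros; lia.
    - destruct IH as [D [HD0 HD]]; [lia|].
      destruct (continuity_ab_maj (fun t => Rabs (Re (c (Rabs t) n)) + Rabs (Im (c (Rabs t) n))) 0 T HT) as [x [Hx _]].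
      + intros t Ht. apply (continuity_pt_plus (fun t => Rabs (Re (c (Rabs t) n))) (fun t => Rabs (Im (c (Rabs t) n)))).
        * apply (continuity_pt_comp (fun t => Re (c (Rabs t) n)) Rabs); [|apply Rcontinuity_abs].
          eapply (is_time_derive_continuity_abs (fun s => Re (c s n))); [lra|].
          apply (coef_ode_component K c true); [exact Hode | lra | lia].
        * apply (continuity_pt_comp (fun t => Im (c (Rabs t) n)) Rabs); [|apply Rcontinuity_abs].
          eapply (is_time_derive_continuity_abs (fun s => Im (c s n))); [lra|].
          apply (coef_ode_component K c false); [exact Hode | lra | lia].
      + set (B := Rabs (Re (c (Rabs x) n)) + Rabs (Im (c (Rabs x) n))) in *.
        exists (Rmax D B). split; [eapply Rle_trans; [exact HD0 | apply Rmax_l]|].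
        intros t k Ht Hk. destruct (Nat.eq_dec k n) as [-> | Hne].
        * eapply Rle_trans; [apply Cmod_le_components|].
          eapply Rle_trans; [|apply Rmax_r]. specialize (Hx t Ht).
          rewrite (Rabs_pos_eq t) in Hx by lra. exact Hx.
        * eapply Rle_trans; [apply HD; [exact Ht | lia] | apply Rmax_l]. }
  destruct (H (S K) (Nat.le_refl _)) as [D [HD0 HD]]. exists D. intros t k Ht.
  destruct (le_dec k K).
  - apply HD; [exact Ht | lia].
  - rewrite (proj1 Hode) by (lra || lia). now rewrite Cmod_0.
Qed.

Lemma coef_ode_unique (K : nat) (c d : R -> nat -> C) :
  coef_ode K c -> coef_ode K d -> (forall k, (k <= K)%nat -> c 0 k = d 0 k) ->
  forall t k, 0 <= t -> c t k = d t k.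
Proof.
  intros Hc Hd H0 T k HT.
  destruct (coef_ode_bounded K c T Hc HT) as [D1 HD1].
  destruct (coef_ode_bounded K d T Hd HT) as [D2 HD2].
  set (D := Rmax D1 D2).
  assert (HcD : forall t j, 0 <= t <= T -> Cmod (c t j) <= D).
  { intros t j Ht. eapply Rle_trans; [apply HD1, Ht | apply Rmax_l]. }
  assert (HdD : forall t j, 0 <= t <= T -> Cmod (d t j) <= D).
  { intros t j Ht. eapply Rle_trans; [apply HD2, Ht | apply Rmax_r]. }
  assert (HD : 0 <= D) by (eapply Rle_trans; [apply Cmod_ge_0 | apply (HcD 0 0%nat); lra]).
  pose proof (pos_INR K) as HINR.
  set (W := (INR K + 6 * INR K ^ 2) * (2 * D)).
  assert (HW : 0 <= W) by (unfold W; apply Rmult_le_pos; nra).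
  assert (Hlin : forall (b : bool) (z z' : C),
    (if b then Re else Im) (z - z')%C = (if b then Re else Im) z - (if b then Re else Im) z').
  { intros b z z'. unfold Cminus. destruct b; [rewrite re_plus, re_opp | rewrite im_plus, im_opp]; ring. }
  set (w := fun t (i : bool * nat) =>
    if le_dec (snd i) K then (if fst i then Re else Im) (c (Rabs t) (snd i) - d (Rabs t) (snd i))%C else 0).
  set (w' := fun t (i : bool * nat) =>
    if le_dec (snd i) K then (if fst i then Re else Im) (coef_rhs K (c t) (snd i) - coef_rhs K (d t) (snd i))%C else 0).
  assert (Hw0 : forall i, w T i = 0).
  (* A bound on the components allows twice that bound on the moduli, whence [2 * W]; [2 * D] bounds
     the difference of two coefficients of modulus at most [D]. *)
  { intros i. apply (linear_inequality_zero (bool * nat) w w' (2 * W + 1) T (2 * D)); [lra | | | | | | lra].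
    - intros [b n]. unfold w; cbn [fst snd]. destruct (le_dec n K); [|reflexivity].
      rewrite Rabs_R0, H0 by assumption. rewrite Hlin. ring.
    - intros [b n] t Ht. unfold w; cbn [fst snd]. destruct (le_dec n K).
      + apply (continuity_pt_ext (fun s => (if b then Re else Im) (c (Rabs s) n) - (if b then Re else Im) (d (Rabs s) n))).
        { intros s. now rewrite Hlin. }
        apply (continuity_pt_minus (fun s => (if b then Re else Im) (c (Rabs s) n)) (fun s => (if b then Re else Im) (d (Rabs s) n))).
        * eapply (is_time_derive_continuity_abs (fun s => (if b then Re else Im) (c s n))); [lra|].
          apply (coef_ode_component K c b); [assumption | lra | assumption].
        * eapply (is_time_derive_continuity_abs (fun s => (if b then Re else Im) (d s n))); [lra|].
          apply (coef_ode_component K d b); [assumption | lra | assumption].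
      + apply continuity_pt_const. intros x y. reflexivity.
    - intros [b n] t Ht. unfold w, w'; cbn [fst snd]. destruct (le_dec n K).
      + rewrite Hlin.
        apply (is_derive_ext_loc (fun s => minus ((if b then Re else Im) (c s n)) ((if b then Re else Im) (d s n)))).
        { exists (mkposreal t (proj1 Ht)). intros s Hs. change (Rabs (s - t) < t) in Hs.
          apply Rabs_lt_between in Hs. rewrite Hlin, (Rabs_pos_eq s) by lra. reflexivity. }
        apply (is_derive_minus (V := R_NormedModule)); apply is_time_derive_is_derive; try lra;
          apply coef_ode_component; (assumption || lra).
      + apply (is_derive_const (V := R_NormedModule)).
    - intros [b n] t Ht. unfold w; cbn [fst snd]. destruct (le_dec n K).
      + rewrite (Rabs_pos_eq t) by lra. eapply Rle_trans; [apply component_le_Cmod|].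
        unfold Cminus. eapply Rle_trans; [apply Cmod_triangle|]. rewrite Cmod_opp.
        specialize (HcD t n Ht). specialize (HdD t n Ht). lra.
      + rewrite Rabs_R0. lra.
    - intros t M Ht HM [b n]. unfold w'; cbn [fst snd].
      assert (HM0 : 0 <= M) by (eapply Rle_trans; [apply Rabs_pos | apply (HM (true, n))]).
      destruct (le_dec n K).
      + eapply Rle_trans; [apply component_le_Cmod|].
        eapply Rle_trans; [apply (coef_rhs_lipschitz K n (c t) (d t) D (2 * M)); [assumption | intros; apply HcD; lra | intros; apply HdD; lra |]|].
        * intros j. destruct (le_dec j K) as [Hj | Hj].
          -- eapply Rle_trans; [apply Cmod_le_components|].
             pose proof (HM (true, j)) as H1. pose proof (HM (false, j)) as H2.
             unfold w in H1, H2; cbn [fst snd] in H1, H2. destruct (le_dec j K); [|lia].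
             rewrite (Rabs_pos_eq t) in H1, H2 by lra. lra.
          -- rewrite (proj1 Hc), (proj1 Hd) by (lra || lia).
             replace (0 - 0)%C with (RtoC 0) by ring. rewrite Cmod_0. lra.
        * fold W. nra.
      + rewrite Rabs_R0. nra. }
  destruct (le_dec k K) as [Hk | Hk].
  - pose proof (Hw0 (true, k)) as H1. pose proof (Hw0 (false, k)) as H2.
    unfold w in H1, H2; cbn [fst snd] in H1, H2. destruct (le_dec k K); [|lia].
    rewrite Rabs_pos_eq in H1, H2 by exact HT.
    rewrite (Hlin true) in H1. rewrite (Hlin false) in H2.
    apply injective_projections; [exact (Rminus_diag_uniq _ _ H1) | exact (Rminus_diag_uniq _ _ H2)].
  - now rewrite (proj1 Hc), (proj1 Hd) by (lra || lia).
Qed.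

Lemma coef_rhs_Fourier_ODE (K n : nat) (c : Z -> R -> C) (t : R) :
  (- (RtoC (IZR (Z.of_nat n)) * c 0%Z t * c (Z.of_nat n) t)
   - sum_n_m (fun j : nat =>
       RtoC (2 * (IZR (Z.of_nat n) + 2 * INR j)) * c (Z.of_nat n + Z.of_nat j)%Z t
       * Cconj (c (Z.of_nat j) t)) 1 K)%C
  = coef_rhs K (fun k => c (Z.of_nat k) t) n.
Proof.
  unfold coef_rhs. rewrite <- INR_IZR_INZ. f_equal. f_equal.
  apply (csum_ext (fun j => RtoC (2 * (INR n + 2 * INR j)) * c (Z.of_nat n + Z.of_nat j)%Z t
       * Cconj (c (Z.of_nat j) t))%C). intros j _. now rewrite Nat2Z.inj_add.
Qed.

Lemma Fourier_ODE_coef_ode (K : nat) (f0 : R -> R) (c : Z -> R -> C) :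
  Fourier_ODE K f0 c -> coef_ode K (fun t k => c (Z.of_nat k) t).
Proof.
  intros [H1 [_ H3]]. split.
  - intros t k Ht Hk. apply H1; [exact Ht | lia].
  - intros t k Ht Hk. destruct (H3 (Z.of_nat k)) as [_ Hd]; [lia|].
    specialize (Hd t Ht). rewrite coef_rhs_Fourier_ODE in Hd. exact Hd.
Qed.

(** The time derivative of [g] is known point by point. Passing through finitely many sample values
    carries it over to the coefficients without differentiating under the integral sign. *)
Lemma solution_Fourier_ODE (K : nat) (f0 : R -> R) (g : R -> R -> R) :
  positive_band_limited_global_solution K f0 g ->
  Fourier_ODE K f0 (fun k t => Fourier (fun x => g x t) k).
Proof.
  intros [[Hper [gx [gt [Hg [Lg [Heq _]]]]]] [Hinit [_ Hband]]].
  assert (Hcont : forall t, 0 <= t -> forall x, continuous (fun y => g y t) x).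
  { intros t Ht x. destruct (Heq x t (time_nonneg t Ht)) as [Hx _].
    apply (ex_derive_continuous (V := R_NormedModule)). now exists (gx x t). }
  set (D := fun t (k : nat) => Fourier (fun x => g x t) (Z.of_nat k)).
  assert (HD : forall t, 0 <= t -> forall x, g x t = tp K (D t) x).
  { intros t Ht. apply (band_limited_tp K (fun x => g x t)).
    - apply Hper, time_nonneg, Ht.
    - now apply Hcont.
    - now apply Hband. }
  assert (HDK : forall t k, 0 <= t -> (K < k)%nat -> D t k = RtoC 0).
  { intros t k Ht Hk. apply Hband; [exact Ht | lia]. }
  (* The functions provided by [strong_solution] are identified with the explicit formulas by
     uniqueness of derivatives and of principal values. *)
  assert (Hrhs : forall x t, 0 <= t -> gt x t = tp K (coef_rhs K (D t)) x).
  { intros x t Ht. destruct (Heq x t (time_nonneg t Ht)) as [Hx [_ [HH [HL ->]]]].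
    rewrite <- tp_coef_rhs; [| apply Fourier_0_real, Hcont, Ht | intros; now apply HDK].
    rewrite <- (HD t Ht x).
    rewrite (is_Hilbert_unique (tp K (D t)) x _ _
      (is_Hilbert_ext _ _ _ _ (HD t Ht) HH) (is_Hilbert_tp K (D t) x)).
    rewrite (is_half_Laplacian_unique (tp K (D t)) x _ _
      (is_half_Laplacian_ext _ _ _ _ (HD t Ht) HL) (is_half_Laplacian_tp K (D t) x)).
    apply (is_derive_ext _ (tp K (D t)) _ _ (HD t Ht)) in Hx.
    apply is_derive_unique in Hx.
    now rewrite <- Hx, (is_derive_unique _ _ _ (is_derive_tp K (D t) x)). }
  split; [|split].
  - intros k t Ht Hk. now apply Hband.
  - intros k t Ht Hk. rewrite <- Fourier_opp_index by now apply Hcont.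
    now rewrite Z.opp_involutive.
  - intros k Hk. split; [apply Fourier_ext; exact Hinit|].
    intros t Ht. rewrite <- (Z2Nat.id k) by lia.
    set (n := Z.to_nat k). assert (Hn : (n <= K)%nat) by lia.
    rewrite (coef_rhs_Fourier_ODE K n (fun k t => Fourier (fun x => g x t) k)). fold (D t).
    (* Enough samples for every [n <= K], as [dft_tp] asks for [K + n < N]. The weights [w] below
       are those of the discrete Fourier transform. *)
    set (N := (2 * K + 1)%nat).
    assert (HN : RtoC (INR N) <> RtoC 0).
    { intros E. apply (f_equal Re) in E. simpl Re in E.
      assert (0 < INR N) by (apply lt_0_INR; lia). unfold RtoC, Re in E; simpl in E. lra. }
    set (w := fun j => (expi (- INR n * (2 * PI / INR N * INR j)) / INR N)%C).
    assert (Hdft : forall c : nat -> C, Im (c 0%nat) = 0 ->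
      csum (fun j => RtoC (tp K c (2 * PI / INR N * INR j)) * w j)%C N = c n).
    { intros c Hc.
      rewrite (csum_ext _ (fun j => / INR N * (RtoC (tp K c (2 * PI / INR N * INR j))
        * expi (- INR n * (2 * PI / INR N * INR j))))%C)
        by (intros; unfold w, Cdiv; ring).
      rewrite csum_mult_l, dft_tp by lia.
      rewrite Cmult_assoc, Cinv_l, Cmult_1_l by exact HN.
      destruct (Nat.eq_dec n 0) as [-> | Hn0].
      - apply injective_projections; [reflexivity | symmetry; exact Hc].
      - destruct (le_dec n K); [reflexivity | lia]. }
    rewrite <- (Hdft (coef_rhs K (D t))) by apply coef_rhs_0_nonpos.
    apply (is_time_derive_ext (fun s => csum (fun j => RtoC (g (2 * PI / INR N * INR j)%R s) * w j)%C N)); [exact Ht | |].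
    + intros s Hs. fold (D s n). rewrite <- Hdft by apply Fourier_0_real, Hcont, Hs.
      apply csum_ext. intros j _. now rewrite HD.
    + rewrite (csum_ext _ (fun j => RtoC (gt (2 * PI / INR N * INR j)%R t) * w j)%C)
        by (intros j _; now rewrite Hrhs).
      apply (is_time_derive_csum p_infty (fun j s => g (2 * PI / INR N * INR j) s)).
      intros j. apply (Heq (2 * PI / INR N * INR j) t (time_nonneg t Ht)).
Qed.

(** * The strong solution and the theorem *)

Lemma trig_sum_tp (K : nat) (c : Z -> C) (x : R) :
  Im (c 0%Z) = 0 ->
  (forall k, (- Z.of_nat K <= k < 0)%Z -> c k = Cconj (c (- k)%Z)) ->
  trig_sum K c x = RtoC (tp K (fun k => c (Z.of_nat k)) x).
Proof.
  intros H0 Hneg. unfold trig_sum.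
  rewrite (csum_symmetric_range (fun k => c k * expi (IZR k * x))%C).
  rewrite (csum_ext _ (fun k => c (Z.of_nat k) * expi (INR k * x) + Cconj (c (Z.of_nat k) * expi (INR k * x)))%C).
  - rewrite csum_plus, <- csum_conj. unfold tp.
    rewrite RtoC_plus, RtoC_mult, (re_alt (csum _ _)), Rmult_0_l, expi_0, Cmult_1_r.
    change (Z.of_nat 0) with 0%Z.
    replace (RtoC (Re (c 0%Z))) with (c 0%Z) by (apply injective_projections; [reflexivity | exact H0]).
    field.
  - intros k Hk. rewrite (Hneg (- Z.of_nat k)%Z) by lia.
    rewrite Z.opp_involutive, Cmult_conj, <- expi_opp, opp_IZR, <- INR_IZR_INZ.
    now rewrite Ropp_mult_distr_l_reverse.
Qed.

(** The multiplier [- i] of the Hilbert transform. With the multipliers [i k] and [k] of the next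
    two lemmas, [Hf], [f_x] and [Lf] are again of the form [tp], so [continuous_tp_spacetime] covers
    them all. *)
Lemma tp_Ci (K : nat) (c : nat -> C) (x : R) :
  Im (c 0%nat) = 0 ->
  tp K (fun k => - Ci * c k)%C x = 2 * Im (csum (fun k => c k * expi (INR k * x))%C K).
Proof.
  intros H0. unfold tp.
  rewrite (csum_ext _ (fun k => - Ci * (c k * expi (INR k * x)))%C) by (intros; ring).
  rewrite csum_mult_l.
  assert (E : forall z, Re (- Ci * z) = Im z) by (intros [a b]; simpl; ring).
  rewrite !E, H0. ring.
Qed.

Lemma tp_derivative (K : nat) (c : nat -> C) (x : R) :
  tp K (fun k => Ci * INR k * c k)%C x
  = -2 * Im (csum (fun k => RtoC (INR k) * (c k * expi (INR k * x)))%C K).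
Proof.
  unfold tp.
  rewrite (csum_ext _ (fun k => Ci * (INR k * (c k * expi (INR k * x))))%C) by (intros; ring).
  rewrite csum_mult_l.
  assert (E : forall z, Re (Ci * z) = - Im z) by (intros [a b]; simpl; ring).
  rewrite E. replace (Ci * INR 0 * c 0%nat)%C with (RtoC 0) by (simpl INR; ring).
  simpl (Re 0). ring.
Qed.

Lemma tp_half_Laplacian (K : nat) (c : nat -> C) (x : R) :
  tp K (fun k => INR k * c k)%C x
  = 2 * Re (csum (fun k => RtoC (INR k) * (c k * expi (INR k * x)))%C K).
Proof.
  unfold tp.
  rewrite (csum_ext _ (fun k => (INR k * (c k * expi (INR k * x))))%C) by (intros; ring).
  replace (INR 0 * c 0%nat)%C with (RtoC 0) by (simpl INR; ring).
  simpl (Re 0). ring.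
Qed.

Lemma continuous_spacetime_of_continuous (T : Rbar) (f : R -> R -> R) :
  (forall p : R * R, continuous (fun q : R * R => f (fst q) (snd q)) p) ->
  continuous_spacetime T f.
Proof.
  intros H p _. eapply filterlim_filter_le_1; [apply filter_le_within | apply H].
Qed.

Lemma coef_solution_strong (K : nat) (c : R -> nat -> C) :
  (forall t k, (K < k)%nat -> c t k = RtoC 0) ->
  (forall t, Im (c t 0%nat) = 0) ->
  (forall k t, continuous (fun s => Re (c s k)) t /\ continuous (fun s => Im (c s k)) t) ->
  (forall k t, 0 <= t -> (k <= K)%nat ->
     is_derive (fun s => Re (c s k)) t (Re (coef_rhs K (c t) k)) /\
     is_derive (fun s => Im (c s k)) t (Im (coef_rhs K (c t) k))) ->
  strong_solution p_infty (fun x t => tp K (c t) x).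
Proof.
  intros HK H0 Hcont Hd. split; [intros; apply periodic_tp|].
  set (fx := fun x t => tp K (fun k => Ci * INR k * c t k)%C x).
  set (Hf := fun x t => tp K (fun k => - Ci * c t k)%C x).
  set (Lf := fun x t => tp K (fun k => INR k * c t k)%C x).
  assert (Cre : forall (a : C) k t, continuous (fun s => Re (a * c s k)) t /\ continuous (fun s => Im (a * c s k)) t).
  { intros a k t. destruct (Hcont k t) as [H1 H2]. split.
    - apply (continuous_ext (fun s => minus (scal (Re a) (Re (c s k))) (scal (Im a) (Im (c s k))))).
      + intros s. rewrite re_mult. reflexivity.
      + apply (continuous_minus (V := R_NormedModule)); now apply (continuous_scal_r (V := R_NormedModule)).
    - apply (continuous_ext (fun s => plus (scal (Re a) (Im (c s k))) (scal (Im a) (Re (c s k))))).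
      + intros s. rewrite im_mult. reflexivity.
      + apply (continuous_plus (V := R_NormedModule)); now apply (continuous_scal_r (V := R_NormedModule)). }
  assert (Cf : forall p : R * R, continuous (fun q : R * R => tp K (c (snd q)) (fst q)) p).
  { intros p. apply (continuous_tp_spacetime K c). intros; apply Hcont. }
  assert (Cfx : forall p : R * R, continuous (fun q : R * R => fx (fst q) (snd q)) p).
  { intros p. apply (continuous_tp_spacetime K (fun t k => Ci * INR k * c t k)%C). intros; apply Cre. }
  assert (CHf : forall p : R * R, continuous (fun q : R * R => Hf (fst q) (snd q)) p).
  { intros p. apply (continuous_tp_spacetime K (fun t k => - Ci * c t k)%C). intros; apply Cre. }
  assert (CLf : forall p : R * R, continuous (fun q : R * R => Lf (fst q) (snd q)) p).
  { intros p. apply (continuous_tp_spacetime K (fun t k => INR k * c t k)%C). intros; apply Cre. }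
  exists fx, (fun x t => Hf x t * fx x t - tp K (c t) x * Lf x t), Hf, Lf.
  split; [|split; [|split; [|split]]].
  - intros x t [Ht _]. split; [|split; [|split; [|split; [|reflexivity]]]].
    + unfold fx. rewrite tp_derivative. apply is_derive_tp.
    + apply is_derive_is_time_derive. unfold Hf, fx, Lf.
      rewrite tp_Ci, tp_derivative, tp_half_Laplacian by apply H0.
      rewrite tp_coef_rhs by auto.
      apply is_derive_tp_coef. intros k Hk. now apply Hd.
    + unfold Hf. rewrite tp_Ci by apply H0. apply is_Hilbert_tp.
    + unfold Lf. rewrite tp_half_Laplacian. apply is_half_Laplacian_tp.
  - now apply continuous_spacetime_of_continuous.
  - now apply continuous_spacetime_of_continuous.
  - apply continuous_spacetime_of_continuous. intros p.
    apply (continuous_minus (V := R_NormedModule)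
      (fun q : R * R => mult (Hf (fst q) (snd q)) (fx (fst q) (snd q)))
      (fun q : R * R => mult (tp K (c (snd q)) (fst q)) (Lf (fst q) (snd q))));
      now apply (continuous_mult (K := R_AbsRing)).
  - now apply continuous_spacetime_of_continuous.
Qed.

Theorem proposition1p1
    (f0 : R -> R) (K : nat)
    (f0_periodic : periodic f0)
    (f0_continuous : forall x, continuous f0 x)
    (f0_positive : forall x, 0 < f0 x)
    (f0_band_limited : band_limited K f0) :
  exists f : R -> R -> R,
    positive_band_limited_global_solution K f0 f /\
    (forall g : R -> R -> R,
       positive_band_limited_global_solution K f0 g ->
       forall x t, 0 <= t -> g x t = f x t) /\
    Fourier_ODE K f0 (fun k t => Fourier (fun x => f x t) k) /\
    (forall c : Z -> R -> C,
       Fourier_ODE K f0 c ->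
       forall x t, 0 <= t -> RtoC (f x t) = trig_sum K (fun k => c k t) x).
Proof.
  assert (Hf0 : forall x, f0 x = tp K (fun k => Fourier f0 (Z.of_nat k)) x)
    by now apply band_limited_tp.
  destruct (coef_global_solution K (fun k => Fourier f0 (Z.of_nat k)))
    as [c [Hc0 [HcK [Him [Hcont [Hd Hpos]]]]]].
  { intros k Hk. apply f0_band_limited. lia. }
  { now apply Fourier_0_real. }
  { intros x. rewrite <- Hf0. apply f0_positive. }
  assert (Hsol : positive_band_limited_global_solution K f0 (fun x t => tp K (c t) x)).
  { split; [|split; [|split]].
    - now apply coef_solution_strong.
    - intros x. rewrite Hf0. apply tp_ext. intros; apply Hc0.
    - exact Hpos.
    - intros t Ht k Hk.
      assert (Hz : forall n : nat, (K < n)%nat -> Fourier (tp K (c t)) (Z.of_nat n) = RtoC 0).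
      { intros n Hn. rewrite Fourier_tp. destruct (Nat.eq_dec n 0); [lia|].
        destruct (le_dec n K); [lia | reflexivity]. }
      destruct (Z_le_dec 0 k).
      + rewrite <- (Z2Nat.id k) by lia. apply Hz. lia.
      + rewrite <- (Z.opp_involutive k).
        rewrite (Fourier_opp_index (tp K (c t)) _ (continuous_tp K (c t))).
        rewrite <- (Z2Nat.id (- k)) by lia. rewrite Hz by lia.
        unfold Cconj, RtoC; simpl; f_equal; ring. }
  pose proof (solution_Fourier_ODE K f0 _ Hsol) as Hode.
  (* Stated for every solution of the system, this is the last claim of the theorem; applied to the
     Fourier coefficients of [g] it also yields uniqueness for the equation. *)
  assert (Huniq : forall d : Z -> R -> C, Fourier_ODE K f0 d -> forall x t, 0 <= t ->
     RtoC (tp K (c t) x) = trig_sum K (fun k => d k t) x).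
  { intros d Hdode x t Ht.
    assert (E : forall k : nat, d (Z.of_nat k) t = Fourier (fun x => tp K (c t) x) (Z.of_nat k)).
    { intros k. apply (coef_ode_unique K (fun t k => d (Z.of_nat k) t)
        (fun t k => Fourier (fun x => tp K (c t) x) (Z.of_nat k))); [| | |exact Ht].
      - exact (Fourier_ODE_coef_ode K f0 d Hdode).
      - exact (Fourier_ODE_coef_ode K f0 _ Hode).
      - intros j Hj. destruct Hdode as [_ [_ H1]]. destruct Hode as [_ [_ H2]].
        destruct (H1 (Z.of_nat j)) as [-> _]; [lia|].
        destruct (H2 (Z.of_nat j)) as [-> _]; [lia|]. reflexivity. }
    rewrite trig_sum_tp.
    - f_equal. rewrite (band_limited_tp K (tp K (c t))).
      + apply tp_ext. intros k _. symmetry. apply E.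
      + apply periodic_tp.
      + apply continuous_tp.
      + destruct Hsol as [_ [_ [_ Hb]]]. now apply Hb.
    (* [Fourier_ODE] does not state that the mean is real; this comes from its identification with a
       Fourier coefficient. *)
    - change 0%Z with (Z.of_nat 0). rewrite E. apply Fourier_0_real. apply continuous_tp.
    - intros k Hk. apply Hdode; assumption. }
  exists (fun x t => tp K (c t) x). split; [exact Hsol|]. split; [|split; [exact Hode | exact Huniq]].
  intros g Hg x t Ht. apply RtoC_inj. rewrite (Huniq _ (solution_Fourier_ODE K f0 g Hg) x t Ht).
  destruct Hg as [[Hper [gx [gt [Hh [Lg [Heq _]]]]]] [_ [_ Hband]]].
  assert (Hgc : forall y, continuous (fun y => g y t) y).
  { intros y. destruct (Heq y t (time_nonneg t Ht)) as [Hx _].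
    apply (ex_derive_continuous (V := R_NormedModule)). now exists (gx y t). }
  rewrite trig_sum_tp.
  - f_equal. apply (band_limited_tp K (fun y => g y t)); [now apply Hper, time_nonneg | exact Hgc | now apply Hband].
  - now apply Fourier_0_real.
  - intros k Hk. rewrite <- Fourier_opp_index by exact Hgc. now rewrite Z.opp_involutive.
Qed.
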